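(* Let $\frac16 < \rho < \frac15$ and $N^\rho \ll Y \ll N^{1-4\rho}$. For any complex numbers $c_\ell, a_x, b_y$ with $|c_\ell| \le 1$, $|a_x| \le 1$, $|b_y| \le 1$, we have \[ \sum_{\ell \le L} c_\ell \sum_{y \sim Y} b_y \sum_{x \in I(y)} a_x\, e(\ell g(xy)) \ll N^{1-10\eta}, \] where for each $y$, $I(y)$ is an arbitrary subinterval of $\left(\frac{N}{2y}, \frac{N}{y}\right]$.
   Context: Fix real numbers $\alpha,\beta,\gamma$ with $\alpha$ irrational. Let $\varepsilon>0$ be a sufficiently small fixed number and $\eta=\varepsilon^9$. Let $a/q$ be a fraction in lowest terms with $|\alpha - a/q| < q^{-2}$, with $q$ sufficiently large, and set $g(x) = \frac{a}{q}x^2 + \beta x + \gamma$. Put $L_1 = 2N^{\rho - \varepsilon/2}$, where $N$ is chosen so that $L_1^{1/2}N \ll q \ll L_1^{1/2} N$, and put $L = N^{\rho - \varepsilon/3}$. Sums over $\ell$, $x$, $y$ are over positive integers. Write $e(\theta)=e^{2\pi i\theta}$; $y \sim Y$ means $Y < y \le 2Y$. The notation $A \ll B$ means $|A| \le CB$ with $C$ depending at most on $\varepsilon$ (uniformly in $q$, $N$, the coefficients and the intervals). *)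

(* Defs.v *)
From mathcomp Require Import all_boot all_order all_algebra.
From mathcomp Require Import all_classical all_reals all_analysis.
From mathcomp Require Import complex.

Set Implicit Arguments.
Unset Strict Implicit.
Unset Printing Implicit Defensive.
Import Order.TTheory GRing.Theory Num.Theory.
Local Open Scope ring_scope.
Local Open Scope complex_scope.

Section Defs.
Variable R : realType.
Implicit Types (N Y eps rho beta gamma theta t : R).

(* e(theta) = exp(2 pi i theta), through Euler's formula *)
Definition e theta : R[i] := cos (2 * pi * theta) +i* sin (2 * pi * theta).

Definition eta eps : R := eps ^+ 9.

Definition L1 N rho eps : R := 2 * N `^ (rho - eps / 2).

Definition L N rho eps : R := N `^ (rho - eps / 3).

Definition g (a : int) (q : nat) beta gamma t : R :=
  a%:~R / q%:R * t ^+ 2 + beta * t + gamma.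

(* For z >= 0 and n : nat, n%:R <= z is equivalent to n < (Num.truncn z).+1.
   The bound on x loses nothing, since the interval I y is always assumed to
   lie below N / y. *)
Definition trilinear_sum (a : int) (q : nat) beta gamma N rho eps Y
    (c u b : nat -> R[i]) (I : nat -> interval R) : R[i] :=
  \sum_(1 <= l < (Num.truncn (L N rho eps)).+1)
    c l * \sum_(1 <= y < (Num.truncn (2 * Y)).+1 | Y < y%:R)
      b y * \sum_(1 <= x < (Num.truncn (N / y%:R)).+1 | x%:R \in I y)
        u x * e (l%:R * g a q beta gamma (x * y)%:R).

End Defs.

(* Main.v *)
Require Import Defs.
From mathcomp Require Import all_boot all_order all_algebra.
From mathcomp Require Import all_classical all_reals all_analysis.
From mathcomp Require Import complex.
From mathcomp Require Import ring lra zify.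

(* Cauchy-Schwarz over x bounds |S|^2 by N/Y times the sum, over pairs of
   (l, y), of quadratic exponential sums in x whose leading coefficient is
   a m / q with m = l y^2 - l' y'^2.  The pairs with m = 0 are few by the
   divisor bound.  For m <> 0, Weyl differencing bounds the squared inner sum by
   a quantity kappa(m) depending on m only, and a second Cauchy-Schwarz, over m,
   separates the number r(m) of representations of m from kappa(m).
   The sum of kappa(m) is a sum over residues modulo q.  The sum of r(m)^2 is
   bounded without loss by applying Cauchy-Schwarz to one of the variables l
   only: r(m)^2 <= L sum_l r_l(m)^2, and the resulting equation
   v - v' = l (y^2 - y'^2) has few solutions (l, y, y') as soon as v <> v'. *)

Set Implicit Arguments.
Unset Strict Implicit.
Unset Printing Implicit Defensive.
Import Order.TTheory GRing.Theory Num.Theory.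
Local Open Scope ring_scope.
Local Open Scope complex_scope.

(** * Divisors and harmonic sums *)

(** Up to small powers of [N], the pairs with [m = 0] contribute [N^2 L / Y]; since [Y >> N^rho],
    the saving is the factor by which [L] falls short of [N^rho]. The sum of [r(m)^2] is
    [<< L^3 Y^2] and the sum of [kappa(m)] is [<< L N Y], so the other pairs contribute [(N / Y)
    (L^3 Y^2 * L N Y)^(1/2) = N L^2 (N Y)^(1/2)], and [Y << N^(1 - 4 rho)] brings this below [N^2].
    The bound for [kappa] amounts to square-root cancellation in mean square: there are [L Y^2]
    values of [m], and [x] has about [N / Y] values. It rests on [N << q << L N]: a smaller modulus
    would make the residue 0 too frequent, a larger one would leave too few periods. *)

Lemma size_divisors_ppart p n : (0 < n)%N ->
  (size (divisors n) <= (logn p n).+1 * size (divisors n`_p^'))%N.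
Proof.
move=> n0; set e := logn p n.
have -> : ((e.+1) * size (divisors n`_p^'))%N =
    size [seq (p ^ i * d)%N | i <- iota 0 e.+1, d <- divisors n`_p^'].
  by rewrite size_allpairs size_iota.
apply: uniq_leq_size (divisors_uniq n) _ => d.
rewrite -dvdn_divisors // => dn.
have d0 : (0 < d)%N by apply: dvdn_gt0 dn.
apply/allpairsP; exists (logn p d, (d`_p^')%N); split.
- by rewrite [_.1]/= mem_iota add0n ltnS dvdn_leq_log.
- by rewrite -dvdn_divisors ?part_gt0 // partn_dvd.
- by rewrite -p_part partnC.
Qed.

(** Each prime power [p ^ e] is treated separately. As [e + 1 <= 2 ^ e], the factor [e + 1] is at
    most [(p ^ e) ^ dl] once [p ^ dl >= 2]; only primes below [P], about [2 ^ (1 / dl)], cost a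
    constant [C1]. *)
Lemma size_divisors_bound (R : realType) (dl : R) : 0 < dl ->
  exists2 C : R, 0 < C & forall n, (0 < n)%N ->
    (size (divisors n))%:R <= C * n%:R `^ dl.
Proof.
move=> dl0.
have ln2 : 0 < ln (2 : R) by rewrite ln_gt0 // ltr1n.
set C1 : R := 1 + (dl * ln 2)^-1.
have C11 : 1 <= C1 by rewrite lerDl invr_ge0 mulr_ge0 ?ltW.
have C10 : 0 <= C1 by apply: le_trans C11.
set P := (Num.truncn (expR (ln 2 / dl) : R)).+2.
have small (p e : nat) : (1 < p)%N -> e.+1%:R <= C1 * (p ^ e)%:R `^ dl :> R.
  move=> p1.
  have h : (2 : R) `^ (e%:R * dl) <= (p ^ e)%:R `^ dl.
    rewrite powRrM powR_mulrn // ge0_ler_powR ?nnegrE ?exprn_ge0 ?(ltW dl0) //.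
    by rewrite natrX lerXn2r ?nnegrE // ler_nat.
  apply: le_trans (ler_wpM2l C10 h).
  rewrite /powR pnatr_eq0 /=.
  apply: le_trans (ler_wpM2l C10 (expR_ge1Dx _)).
  rewrite /C1 mulrDl mul1r mulrDr mulr1.
  have -> : (dl * ln 2)^-1 * (e%:R * dl * ln 2) = e%:R :> R.
    by field; rewrite !gt_eqF.
  have : 0 <= e%:R * dl * ln 2 :> R by rewrite !mulr_ge0 ?(ltW dl0) ?(ltW ln2).
  have : 0 <= (dl * ln 2)^-1 :> R by rewrite invr_ge0 mulr_ge0 ?(ltW dl0) ?(ltW ln2).
  rewrite -natr1; lra.
have large (p e : nat) : (P <= p)%N -> e.+1%:R <= (p ^ e)%:R `^ dl :> R.
  move=> Pp; have h : (2 : R) <= p%:R `^ dl.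
    have -> : (2 : R) = expR (ln 2 / dl) `^ dl.
      by rewrite -expRM divfK ?gt_eqF // lnK // posrE.
    rewrite ge0_ler_powR ?nnegrE ?expR_ge0 ?(ltW dl0) //.
    have /andP[_ /ltW h] := truncn_itv (expR_ge0 (ln 2 / dl)).
    by apply: le_trans h _; rewrite ler_nat; apply: leq_trans Pp; rewrite /P.
  have -> : (p ^ e)%:R `^ dl = (p%:R `^ dl) ^+ e :> R.
    by rewrite natrX -powR_mulrn // -powRrM mulrC powRrM powR_mulrn ?powR_ge0.
  apply: (@le_trans _ _ (2 ^+ e)); last by rewrite lerXn2r ?nnegrE ?powR_ge0.
  by rewrite -natrX ler_nat ltn_expl.
(* Induction on a strict bound [k] for the prime factors. The exponent [minn k P] counts composite
   numbers too, which only enlarges the constant, as [logn k n = 0] for them. *)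
have main k n : (0 < n)%N -> (forall p, p \in primes n -> (p < k)%N) ->
    (size (divisors n))%:R <= C1 ^+ minn k P * n%:R `^ dl.
  elim: k n => [|k IH] n n0 hn.
    have -> : n = 1%N.
      apply/eqP; rewrite eqn_leq n0 andbT leqNgt; apply/negP => n1.
      by have := hn (pdiv n); rewrite ltn0 mem_primes pdiv_prime // n0 pdiv_dvd => /(_ isT).
    by rewrite min0n expr0 mul1r powR1.
  set m := (n`_k^')%N.
  have m0 : (0 < m)%N by rewrite part_gt0.
  have hm p : p \in primes m -> (p < k)%N.
    rewrite /m primes_part mem_filter => /andP[pk /hn].
    rewrite ltnS leq_eqVlt => /orP[/eqP pE|//].
    by move: pk; rewrite pE !inE eqxx.
  have := IH _ m0 hm => {}IH.
  set e := logn k n.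
  have nE : n%:R `^ dl = (k ^ e)%:R `^ dl * m%:R `^ dl :> R.
    by rewrite -powRM // -natrM /e -p_part /m partnC.
  have step : e.+1%:R * C1 ^+ minn k P <= C1 ^+ minn k.+1 P * (k ^ e)%:R `^ dl.
    have [e0|e0] := posnP e.
      rewrite e0 expn0 powR1 mulr1 mul1r ler_weXn2l //; lia.
    have kp : prime k by move: e0; rewrite /e logn_gt0 mem_primes => /andP[].
    have [kP|kP] := ltnP k P.
      have -> : minn k.+1 P = k.+1 by apply/minn_idPl.
      rewrite exprSr -mulrA [leLHS]mulrC ler_wpM2l ?exprn_ge0 //.
      by apply: small; rewrite prime_gt1.
    have -> : minn k.+1 P = P by apply/minn_idPr/leqW.
    rewrite [leLHS]mulrC ler_wpM2l ?exprn_ge0 //.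
    exact: large.
  rewrite nE mulrA; apply: le_trans (ler_wpM2r (powR_ge0 _ _) step).
  rewrite -mulrA; apply: le_trans (ler_wpM2l _ IH) => //.
  by rewrite -natrM ler_nat size_divisors_ppart.
exists (C1 ^+ P); first by rewrite exprn_gt0 // (lt_le_trans _ C11).
move=> n n0; apply: le_trans (main n.+1 n n0 _) _.
  by move=> p; rewrite mem_primes ltnS => /and3P[_ _ /dvdn_leq]; exact.
by rewrite ler_wpM2r ?powR_ge0 // ler_weXn2l // geq_minr.
Qed.

(** A power of [q] replaces the usual logarithm so that this loss has the same shape as that of the
    divisor bound. *)
Lemma harmonic_bound (R : realType) (dl : R) (q : nat) : 0 < dl -> (0 < q)%N ->
  \sum_(1 <= r < q.+1) (r%:R : R)^-1 <= (1 + dl^-1) * q%:R `^ dl.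
Proof.
move=> dl0 q0; have q1 : 1 <= q%:R :> R by rewrite ler1n.
apply: (@le_trans _ _ (1 + ln (q%:R : R))).
  case: q q0 {q1} => // q _; elim: q => [|q IH].
    by rewrite big_nat1 ln1 addr0 invr1.
  rewrite big_nat_recr //=.
  apply: le_trans (lerD IH (lexx _)) _.
  have q1 : (0 : R) < q.+1%:R by rewrite ltr0n.
  have q2 : (0 : R) < q.+2%:R by rewrite ltr0n.
  have : ln (q.+1%:R / q.+2%:R : R) <= - (q.+2%:R)^-1.
    have -> : q.+1%:R / q.+2%:R = 1 + - (q.+2%:R)^-1 :> R.
      by rewrite -(@natr1 _ q.+1); field; rewrite nat1r natr1 gt_eqF.
    by apply: le_ln1Dx; rewrite ltrN2 invf_lt1 // ltr1n.
  by rewrite ln_div ?posrE //; move: (_^-1) => z; lra.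
rewrite mulrDl mul1r lerD //.
  by have := ler_powR q1 (ltW dl0); rewrite powRr0.
rewrite mulrC ler_pdivlMr // mulrC /powR gt_eqF ?(lt_le_trans ltr01) //.
by apply: le_trans (expR_ge1Dx _); rewrite lerDr.
Qed.

(** * Exponential sums *)

Section ComplexModulus.
Variable R : realType.
Implicit Types z w : R[i].

(* The norm [`|z|] of the library takes its values in [R[i]]. *)
Definition nrm z : R := ComplexField.Normc.normc z.

Lemma normE z : `|z| = (nrm z)%:C. Proof. by case: z. Qed.

Lemma nrm_ge0 z : 0 <= nrm z. Proof. by case: z => x y; exact: sqrtr_ge0. Qed.

Lemma nrmM z w : nrm (z * w) = nrm z * nrm w. Proof. exact: ComplexField.Normc.normcM. Qed.

Lemma nrmD z w : nrm (z + w) <= nrm z + nrm w.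
Proof. by rewrite -lecR rmorphD /= -!normE ler_normD. Qed.

Lemma nrm_le1 z : `|z| <= 1 -> nrm z <= 1.
Proof. by rewrite normE -[1]/((1 : R)%:C) lecR. Qed.

Lemma nrm0 : nrm 0 = 0. Proof. exact: ComplexField.Normc.normc0. Qed.

Lemma nrm_conj z : nrm z^*%R = nrm z.
Proof. by apply: (@complexI R); rewrite -!normE norm_conjC. Qed.

Lemma nrmN z : nrm (- z) = nrm z.
Proof. by apply: (@complexI R); rewrite -!normE normrN. Qed.

Lemma nrm_real (x : R) : 0 <= x -> nrm x%:C = x.
Proof. by move=> x0; rewrite /nrm /= expr0n addr0 sqrtr_sqr ger0_norm. Qed.

Lemma nrm_sum (I : Type) (r : seq I) (P : pred I) (F : I -> R[i]) :
  nrm (\sum_(i <- r | P i) F i) <= \sum_(i <- r | P i) nrm (F i).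
Proof.
elim/big_rec2: _ => [|i x y _ h]; first by rewrite nrm0.
by apply: le_trans (nrmD _ _) _; rewrite lerD2l.
Qed.

Lemma sqr_nrm z : (nrm z ^+ 2)%:C = z * z^*.
Proof. by rewrite -normCK normE rmorphXn. Qed.

Lemma sqr_sum_offdiag (f : nat -> R[i]) n :
  (\sum_(i < n) f i) * (\sum_(i < n) f i)^* =
  (\sum_(i < n) nrm (f i) ^+ 2)%:C
  + \sum_(k < n) \sum_(i < k) f k * (f i)^*
  + (\sum_(k < n) \sum_(i < k) f k * (f i)^*)^*.
Proof.
elim: n => [|n IH]; first by rewrite !big_ord0 !rmorph0 !addr0 mul0r.
rewrite !big_ord_recr /= -mulr_sumr -rmorph_sum.
move: IH; set S := \sum_(i < n) f i; set A := \sum_(k < n) _; set T := \sum_(i < n) _.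
move=> IH; rewrite !rmorphD /= sqr_nrm !rmorphM /= conjCK.
rewrite mulrDl !mulrDr IH; ring.
Qed.

Lemma diagonals (V : nmodType) (F : nat -> nat -> V) n :
  \sum_(k < n) \sum_(i < k) F k i =
  \sum_(1 <= h < n) \sum_(i < n - h) F (i + h)%N i.
Proof.
elim: n => [|n IH]; first by rewrite big_ord0 big_geq.
rewrite big_ord_recr /= IH; case: n {IH} => [|n].
  by rewrite big_ord0 !big_geq // addr0.
rewrite [RHS]big_nat_recr //= subSnn big_ord1 add0n.
have -> : \sum_(1 <= h < n.+1) \sum_(i < n.+2 - h) F (i + h)%N i =
  \sum_(1 <= h < n.+1) \sum_(i < n.+1 - h) F (i + h)%N i +
  \sum_(1 <= h < n.+1) F n.+1 (n.+1 - h)%N.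
  rewrite -big_split; apply: eq_big_nat => h /andP[h1 hn].
  by rewrite subSn 1?ltnW //= big_ord_recr /= subnK // ltnW.
rewrite -!addrA; congr (_ + _).
rewrite -(big_mkord xpredT (fun i => F n.+1 i)) big_ltn // addrC; congr (_ + _).
rewrite big_nat_rev /=; apply: eq_big_nat => h /andP[h1 hn].
by congr (F _ _); lia.
Qed.

(** Weyl differencing: off-diagonal pairs are grouped by their difference [h], and the factor 2
    accounts for the conjugate pairs. *)
Lemma sqr_nrm_sum_le (f : nat -> R[i]) n : (forall i, nrm (f i) <= 1) ->
  nrm (\sum_(i < n) f i) ^+ 2 <=
  n%:R + 2 * \sum_(1 <= h < n) nrm (\sum_(i < n - h) f (i + h)%N * (f i)^*).
Proof.
move=> f1; have := sqr_sum_offdiag f n; rewrite -sqr_nrm.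
rewrite (diagonals (fun k i => f k * (f i)^*)).
set A : R[i] := \sum_(1 <= h < n) _; set D := \sum_(i < n) nrm (f i) ^+ 2 => E.
have -> : nrm (\sum_(i < n) f i) ^+ 2 = nrm ((D%:C + A + A^*) : R[i]).
  by rewrite -E nrm_real // exprn_ge0 // nrm_ge0.
apply: le_trans (nrmD _ _) _; rewrite nrm_conj.
apply: (@le_trans _ _ (D + nrm A + nrm A)).
  rewrite lerD2r; apply: le_trans (nrmD _ _) _; rewrite nrm_real //.
  by apply: sumr_ge0 => i _; rewrite exprn_ge0 // nrm_ge0.
rewrite -addrA lerD //.
  rewrite -[X in _ <= X%:R](card_ord n) -sumr_const; apply: ler_sum => i _.
  by rewrite exprn_ile1 ?nrm_ge0.
have := nrm_sum (index_iota 1 n) xpredT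
  (fun h => \sum_(i < n - h) f (i + h)%N * (f i)^*).
by rewrite -/A; lra.
Qed.

Lemma cauchy_schwarz (I : Type) (r : seq I) (P : pred I) (a b : I -> R) :
  (\sum_(i <- r | P i) a i * b i) ^+ 2 <=
  (\sum_(i <- r | P i) a i ^+ 2) * (\sum_(i <- r | P i) b i ^+ 2).
Proof.
set A := \sum_(i <- r | P i) a i ^+ 2; set B := \sum_(i <- r | P i) b i ^+ 2.
set S := \sum_(i <- r | P i) a i * b i.
have A0 : 0 <= A by apply: sumr_ge0 => i _; exact: sqr_ge0.
have key s t : 0 <= s ^+ 2 * A - 2 * s * t * S + t ^+ 2 * B.
  rewrite /A /B /S !mulr_sumr -sumrB -big_split /=.
  apply: sumr_ge0 => i _; have := sqr_ge0 (s * a i - t * b i); nra.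
have [A00|A1] := eqVneq A 0.
  have B0 : 0 <= B by apply: sumr_ge0 => i _; exact: sqr_ge0.
  (* For [A = 0] the quadratic form at [(B + 1, S)] is [- (B + 2) S ^ 2], which forces [S = 0]. *)
  have := key (B + 1) S; rewrite A00 mulr0 mul0r => h.
  have := mulr_ge0 B0 (sqr_ge0 S); nra.
have Ap : 0 < A by rewrite lt_neqAle eq_sym A1.
have := key S A; have -> : S ^+ 2 * A - 2 * S * A * S + A ^+ 2 * B = A * (A * B - S ^+ 2) by ring.
by rewrite pmulr_rge0 // subr_ge0.
Qed.

(** Cauchy-Schwarz over [t] removes the arbitrary coefficients [u]. The range of [t] is common to
    all [j], so opening the square leaves sums over [t] inside. *)
Lemma sqr_trilinear_le (T J : finType) (u : T -> R[i]) (f : J -> T -> R[i]) :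
  (forall t, nrm (u t) <= 1) ->
  nrm (\sum_t u t * \sum_j f j t) ^+ 2 <=
  #|T|%:R * \sum_j \sum_k nrm (\sum_t f j t * (f k t)^*).
Proof.
move=> u1.
apply: (@le_trans _ _ ((\sum_(t : T) 1 * nrm (\sum_j f j t)) ^+ 2)).
  rewrite lerXn2r ?nnegrE ?nrm_ge0 ?sumr_ge0 //.
    by move=> t _; rewrite mul1r nrm_ge0.
  apply: le_trans (nrm_sum _ _ _) _; apply: ler_sum => t _.
  by rewrite nrmM ler_wpM2r ?nrm_ge0.
apply: le_trans (cauchy_schwarz _ _ _ _) _.
have -> : \sum_(t : T) (1 : R) ^+ 2 = #|T|%:R.
  by under eq_bigr do rewrite expr1n; rewrite sumr_const.
rewrite ler_wpM2l //.
have E : (\sum_t nrm (\sum_j f j t) ^+ 2)%:C =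
    \sum_j \sum_k \sum_t f j t * (f k t)^*.
  rewrite rmorph_sum /=; under eq_bigr do rewrite sqr_nrm rmorph_sum mulr_suml.
  rewrite exchange_big; apply: eq_bigr => j _ /=.
  under eq_bigr do rewrite mulr_sumr.
  by rewrite exchange_big.
have <- : nrm (\sum_t nrm (\sum_j f j t) ^+ 2)%:C = \sum_t nrm (\sum_j f j t) ^+ 2.
  by rewrite nrm_real // sumr_ge0 // => t _; rewrite exprn_ge0 // nrm_ge0.
rewrite E; apply: le_trans (nrm_sum _ _ _) _; apply: ler_sum => j _.
exact: nrm_sum.
Qed.
End ComplexModulus.

(** * Geometric and quadratic exponential sums *)

Section Exponential.
Import numFieldNormedType.Exports.
Variable R : realType.
Implicit Types s t : R.

Lemma eD s t : e (s + t) = e s * e t.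
Proof.
by rewrite /e !mulrDr cosD sinD; apply/eqP; rewrite eq_complex /= eqxx /= addrC eqxx.
Qed.

Lemma e0 : e (0 : R) = 1.
Proof. by rewrite /e mulr0 cos0 sin0. Qed.

Lemma conj_e t : (e t)^*%R = e (- t).
Proof. by rewrite -[LHS]/(conjc _) /e /= mulrN cosN sinN. Qed.

Lemma nrm_e t : nrm (e t) = 1.
Proof. by rewrite /nrm /= cos2Dsin2 sqrtr1. Qed.

Lemma e_nat n : e (n%:R : R) = 1.
Proof.
elim: n => [|n IH]; first exact: e0.
rewrite -natr1 eD IH mul1r /e mulr1.
by rewrite mulr_natl cos2pi sin2pi.
Qed.

Lemma e_int (z : int) : e (z%:~R : R) = 1.
Proof.
case: z => n; first exact: e_nat.
by rewrite NegzE mulrNz -conj_e e_nat rmorph1.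
Qed.

(** By the mean value theorem [sin x = cos c * x] with [c] in [[0, x]], and
    [cos c >= cos 1 = 1 - 2 sin(1/2)^2 >= 1/2]. *)
Lemma sin_ge_half (x : R) : 0 <= x <= 1 -> x / 2 <= sin x.
Proof.
move=> /andP[x0 x1].
have sinx (y : R) : 0 <= y -> exists2 c, c \in `[0, y] & sin y = cos c * y.
  move=> y0; have sinc : {within `[0, y], continuous (@sin R)}%classic.
    by apply: derivable_within_continuous => z _; exact: derivable_sin.
  have [c cI] := @MVT_segment R sin cos 0 y y0
    (fun z _ => is_derive_sin z) sinc.
  by rewrite sin0 !subr0; exists c.
have cos1 : 2^-1 <= cos (1 : R).
  have -> : (1 : R) = 2^-1 *+ 2 by rewrite mulr2n; lra.
  rewrite cos_mulr2n -[cos _ ^+ 2]/(cos _ ^+ 2) cos2sin2.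
  have [c _ ->] := sinx 2^-1 ltac:(lra).
  have : (cos c * 2^-1) ^+ 2 <= 4^-1.
    rewrite exprMn; have : cos c ^+ 2 <= 1 by rewrite -(cos2Dsin2 c) lerDl sqr_ge0.
    rewrite !expr2; lra.
  rewrite mulr2n; lra.
have [c /[!in_itv] /= /andP[c0 cx] ->] := sinx x x0.
rewrite mulrC ler_wpM2r //; apply: le_trans cos1 _.
have pi2 := pi_ge2 R.
case: (ltgtP c 1) => [c1|c1|->] //; last by lra.
by rewrite ltW // ltr_cos // in_itv /=; lra.
Qed.

(** The polynomial [t * (1 - t)] stands in for the distance from [t] to the nearest integer: it has
    the symmetry of the sine under [t -> 1 - t], and its inverse splits into partial fractions. *)
Lemma sin_pi_ge t : 0 <= t <= 1 -> t * (1 - t) <= sin (pi * t).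
Proof.
have pi2 := pi_ge2 R.
wlog th : t / t <= 2^-1.
  move=> H t01; have [h|h] := lerP t 2^-1; first exact: H.
  have -> : sin (pi * t) = sin (pi * (1 - t)).
    by rewrite mulrBr mulr1 sinB sinpi cospi mul0r sub0r mulN1r opprK.
  apply: le_trans (H (1 - t) _ _); lra.
move=> /andP[t0 t1].
have [h|h] := lerP (pi * t) 1.
  apply: le_trans (sin_ge_half (x := pi * t) _); nra.
have : sin 1 <= sin (pi * t).
  by rewrite ltW // ltr_sin // in_itv /=; nra.
have := @sin_ge_half 1; nra.
Qed.

Lemma nrm_1Be t : 0 <= t <= 1 -> 2 * (t * (1 - t)) <= nrm (1 - e t).
Proof.
move=> t01; have := sin_pi_ge t01 => h.
have h0 : 0 <= t * (1 - t) by nra.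
have -> : 2 * (t * (1 - t)) = Num.sqrt ((2 * (t * (1 - t))) ^+ 2).
  by rewrite sqrtr_sqr ger0_norm // mulr_ge0.
rewrite /nrm /= ler_sqrt; last first.
  by rewrite addr_ge0 ?sqr_ge0.
have -> : 2 * pi * t = (pi * t) *+ 2 by rewrite mulr2n; ring.
rewrite add0r sqrrN cos_mulr2n sin_mulr2n cos2sin2.
set S := sin _ in h *.
have -> : (cos (pi * t) * S *+ 2) ^+ 2 = 4 * (S ^+ 2 * (1 - S ^+ 2)).
  by rewrite -cos2sin2 /S !mulr2n; ring.
rewrite !mulr2n !expr2; nra.
Qed.

Lemma geometric_e t n : (1 - e t) * (\sum_(i < n) e (t * i%:R)) = 1 - e (t * n%:R).
Proof.
elim: n => [|n IH]; first by rewrite big_ord0 !mulr0 e0 subrr.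
rewrite big_ord_recr /= mulrDr IH -natr1 [t * (_ + 1)]mulrDr mulr1 eD; ring.
Qed.

Lemma nrm_geometric_e t n : 0 < t < 1 ->
  nrm (\sum_(i < n) e (t * i%:R)) <= (t * (1 - t))^-1.
Proof.
move=> /andP[t0 t1].
have p0 : 0 < t * (1 - t) by rewrite mulr_gt0 ?subr_gt0.
have h : 2 * (t * (1 - t)) <= nrm (1 - e t) by apply: nrm_1Be; lra.
have : nrm (1 - e t) * nrm (\sum_(i < n) e (t * i%:R)) <= 2.
  rewrite -nrmM geometric_e; apply: le_trans (nrmD _ _) _.
  by rewrite nrmN -[X in nrm X + _]e0 !nrm_e.
move=> H.
rewrite -(ler_pM2l p0) mulfV ?gt_eqF //.
have := nrm_ge0 (\sum_(i < n) e (t * i%:R)); nra.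
Qed.


(* The bound [min (X, 1 / ||z / q||)] for a geometric sum of ratio [e (z / q)],
   in a form that is easy to sum over the residues of [z]. *)
Definition geometric_bound (q X : nat) (z : int) : R :=
  if (z %% q)%Z == 0 then X%:R
  else q%:R ^+ 2 / ((z %% q)%Z%:~R * (q%:R - (z %% q)%Z%:~R)).

Lemma geometric_bound_ge0 q X z : (0 < q)%N -> 0 <= geometric_bound q X z.
Proof.
move=> q0; rewrite /geometric_bound; case: ifP => // _.
have r0 : (0 : R) <= (z %% q)%Z%:~R by rewrite ler0z modz_ge0 // lt0n_neq0.
have rq : (z %% q)%Z%:~R <= q%:R :> R.
  by rewrite -[q%:R]/(q%:~R) ler_int ltW // ltz_pmod.
by rewrite divr_ge0 ?sqr_ge0 // mulr_ge0 // subr_ge0.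
Qed.

Lemma nrm_linear_sum q X (z : int) n c : (0 < q)%N -> (n <= X)%N ->
  nrm (\sum_(i < n) e (z%:~R / q%:R * i%:R + c)) <= geometric_bound q X z.
Proof.
move=> q0 nX; have qR : (0 : R) < q%:R by rewrite ltr0n.
set r := (z %% q)%Z.
have zE : z%:~R / q%:R = (z %/ q)%Z%:~R + r%:~R / q%:R :> R.
  by rewrite {1}(divz_eq z q) rmorphD rmorphM /= mulrDl mulfK ?gt_eqF.
have -> : \sum_(i < n) e (z%:~R / q%:R * i%:R + c) =
    (\sum_(i < n) e (r%:~R / q%:R * i%:R)) * e c.
  rewrite mulr_suml; apply: eq_bigr => i _.
  rewrite eD zE mulrDl eD; congr (_ * _).
  by rewrite -[i%:R]/(i%:~R) -intrM e_int mul1r.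
rewrite nrmM nrm_e mulr1 /geometric_bound -/r; case: eqP => [_|/eqP r0].
  apply: le_trans (nrm_sum _ _ _) _.
  under eq_bigr do rewrite nrm_e.
  by rewrite sumr_const card_ord ler_nat.
have r1 : (0 : R) < r%:~R.
  by rewrite ltr0z lt_neqAle eq_sym r0 modz_ge0 // lt0n_neq0.
have rq : r%:~R < q%:R :> R by rewrite -[q%:R]/(q%:~R) ltr_int ltz_pmod.
have t01 : 0 < (r%:~R / q%:R : R) < 1 by rewrite divr_gt0 //= ltr_pdivrMr // mul1r.
apply: le_trans (nrm_geometric_e n t01) _.
rewrite le_eqVlt; apply/orP; left; apply/eqP; field.
by rewrite !gt_eqF // subr_gt0.
Qed.

(** Differencing cancels [D] and turns [B] into a constant phase, so the bound depends on [z] and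
    [X] alone. It covers every length up to [X], which is what permits arbitrary intervals for
    [x]. *)
Lemma nrm_quadratic_sum q X (z : int) n B D : (0 < q)%N -> (n <= X)%N ->
  nrm (\sum_(i < n) e (z%:~R / q%:R * i%:R ^+ 2 + B * i%:R + D)) ^+ 2 <=
  X%:R + 2 * \sum_(1 <= h < X) geometric_bound q X (2 * h%:Z * z).
Proof.
move=> q0 nX.
set f := fun i : nat => e (z%:~R / q%:R * i%:R ^+ 2 + B * i%:R + D).
apply: le_trans (@sqr_nrm_sum_le _ f n _) _; first by move=> i; rewrite nrm_e.
rewrite /f.
apply: lerD; first by rewrite ler_nat.
rewrite ler_wpM2l //.
apply: (@le_trans _ _ (\sum_(1 <= h < n) geometric_bound q X (2 * h%:Z * z))).
  apply: ler_sum => h _.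
  set c := z%:~R / q%:R * h%:R ^+ 2 + B * h%:R.
  have -> : \sum_(i < n - h) e (z%:~R / q%:R * (i + h)%:R ^+ 2 + B * (i + h)%:R + D) *
      (e (z%:~R / q%:R * i%:R ^+ 2 + B * i%:R + D))^* =
    \sum_(i < n - h) e ((2 * h%:Z * z)%:~R / q%:R * i%:R + c).
    apply: eq_bigr => i _; rewrite conj_e -eD; congr e.
    rewrite !intrM natrD /c -[h%:Z%:~R]/(h%:R) -[2%:~R]/(2%:R); ring.
  by apply: nrm_linear_sum => //; apply: leq_trans nX; exact: leq_subr.
case: n nX => [|n] nX.
  by rewrite [leLHS]big_geq //; apply: sumr_ge0 => h _; exact: geometric_bound_ge0.
rewrite (@big_cat_nat _ _ _ n.+1 1 X) //= lerDl.
by apply: sumr_ge0 => h _; exact: geometric_bound_ge0.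
Qed.

End Exponential.

(** Turns a range cut out by real intervals into a block of consecutive integers, to which
    differencing applies. *)
Lemma convex_pred_nat (P : pred nat) n :
  (forall i j k, P i -> P k -> (i <= j <= k)%N -> P j) ->
  exists s m, (s + m <= n)%N /\
    forall t, (t < n)%N -> P t = (s <= t < s + m)%N.
Proof.
move=> conv.
have [hex|hex] := boolP [exists t : 'I_n, P t]; last first.
  exists 0%N, 0%N; split => // t tn; apply/negP => Pt.
  by case/existsP: hex; exists (Ordinal tn).
have ex : exists t, (t < n)%N && P t.
  by case/existsP: hex => t Pt; exists t; rewrite ltn_ord.
have ub t : (t < n)%N && P t -> (t <= n)%N by case/andP => /ltnW.
case: (ex_minnP ex) => s /andP[sn Ps] smin.
case: (ex_maxnP ex ub) => k /andP[kn Pk] kmax.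
have sk : (s <= k)%N by apply: smin; rewrite kn.
exists s, (k.+1 - s)%N; rewrite subnKC; last exact: leqW.
split => // t tn; apply/idP/andP => [Pt|[st tk]].
  by rewrite smin ?tn // ltnS kmax ?tn.
by apply: conv Ps Pk _; rewrite st -ltnS.
Qed.

(** Translating the block to start at 0 changes only the linear and constant coefficients, on which
    the bound does not depend. *)
Lemma nrm_quadratic_sum_convex (R : realType) q X (z : int) (B D : R) (P : pred nat) :
  (0 < q)%N -> (forall i j k, P i -> P k -> (i <= j <= k)%N -> P j) ->
  nrm (\sum_(t < X | P t) e (z%:~R / q%:R * t.+1%:R ^+ 2 + B * t.+1%:R + D)) ^+ 2 <=
  X%:R + 2 * \sum_(1 <= h < X) geometric_bound R q X (2 * h%:Z * z).
Proof.
move=> q0 conv; have [s [m [sm Pst]]] := convex_pred_nat X conv.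
set F := fun t : nat => e (z%:~R / q%:R * t.+1%:R ^+ 2 + B * t.+1%:R + D).
have -> : \sum_(t < X | P t) F t = \sum_(i < m) F (i + s)%N.
  rewrite -(big_mkord P F) -(big_mkord xpredT (fun i => F (i + s)%N)).
  have -> : \sum_(0 <= i < m) F (i + s)%N = \sum_(s <= t < s + m) F t.
    by rewrite -{2}[s]add0n big_addn addKn.
  rewrite (@big_cat_nat _ _ _ s) //=; last by lia.
  rewrite (@big_cat_nat _ _ _ (s + m)%N s) //=; last by lia.
  rewrite big_nat_cond big_pred0 ?add0r; last first.
    by move=> i; apply/negP => /andP[/andP[_ h]]; rewrite Pst; lia.
  rewrite [X in _ + X]big_nat_cond [X in _ + X]big_pred0 ?addr0; last first.
    by move=> i; apply/negP => /andP[/andP[h h']]; rewrite Pst //; lia.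
  rewrite big_nat_cond [RHS]big_nat_cond; apply: eq_bigl => i.
  by case: (boolP (s <= i < s + m)%N) => //= h; rewrite Pst; lia.
set b := z%:~R / q%:R * (2 * s.+1%:R) + B.
set d := z%:~R / q%:R * s.+1%:R ^+ 2 + B * s.+1%:R + D.
have -> : \sum_(i < m) F (i + s)%N =
    \sum_(i < m) e (z%:~R / q%:R * i%:R ^+ 2 + b * i%:R + d).
  apply: eq_bigr => i _; rewrite /F; congr e.
  by rewrite -addnS natrD /b /d; ring.
by apply: nrm_quadratic_sum => //; lia.
Qed.

(** * Counting *)

Lemma leq_card_size (T : finType) (U : eqType) (A : {set T}) (f : T -> U) (s : seq U) :
  {in A &, injective f} -> (forall t, t \in A -> f t \in s) -> (#|A| <= size s)%N.
Proof.
move=> finj fs; rewrite cardE -(size_map f); apply: uniq_leq_size.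
  by rewrite map_inj_in_uniq ?enum_uniq // => x y; rewrite !mem_enum; exact: finj.
by move=> u /mapP[t]; rewrite mem_enum => tA ->; exact: fs.
Qed.

(** Meant for an [f] that is a product of variables, where [D] bounds the number of factorizations
    of a value. *)
Lemma sum_fiber_le (R : numDomainType) (T : finType) (f : T -> nat) (G : nat -> R) K D :
  (forall t, (f t < K)%N) -> (forall k, 0 <= G k) ->
  (forall t, (#|[set s | f s == f t]| <= D)%N) ->
  \sum_t G (f t) <= D%:R * \sum_(0 <= k < K) G k.
Proof.
move=> fK G0 fD.
have -> : \sum_t G (f t) = \sum_(k < K) \sum_(t | f t == k) G k.
  rewrite (partition_big (fun t => Ordinal (fK t)) xpredT) //=.
  apply: eq_bigr => k _; apply: eq_big => [t|t /eqP <-] //.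
rewrite big_mkord mulr_sumr; apply: ler_sum => k _.
rewrite sumr_const -[leLHS]mulr_natl ler_wpM2r // ler_nat.
have [[t /eqP tk]|h] := pselect (exists t, f t == k).
  by apply: leq_trans (fD t); rewrite -cardsE tk.
by rewrite eq_card0 // => t; apply/negP => tk; apply: h; exists t.
Qed.

Lemma big_pair (V : Type) (idx : V) (op : Monoid.com_law idx) (I K : finType)
    (F : I * K -> V) :
  \big[op/idx]_p F p = \big[op/idx]_i \big[op/idx]_k F (i, k).
Proof. by rewrite pair_bigA; apply: eq_bigr => -[]. Qed.

(** * Representations of an integer as [l y^2 - l' y'^2] *)

Section Counting.
Variables (nL nY B D : nat).
Hypothesis divD : forall k, (0 < k <= B)%N -> (size (divisors k) <= D)%N.
Let J := ('I_nL * 'I_nY)%type.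

(** Up to the factor [a / q], the coefficient of [x^2] in [l g(x y)]. An ordinal stands for its
    successor, since [l] and [y] are positive. *)
Definition wsq (j : 'I_nL * 'I_nY) : nat := (j.1.+1 * j.2.+1 ^ 2)%N.

Lemma wsq_gt0 j : (0 < wsq j)%N.
Proof. by rewrite muln_gt0 expn_gt0. Qed.

Lemma wsq_le j : (wsq j <= nL * nY ^ 2)%N.
Proof. by rewrite leq_mul // leq_exp2r. Qed.

Hypothesis MB : (nL * nY ^ 2 <= B)%N.

(** In [l y^2 = k] the factor [y] divides [k] and determines [l]. *)
Lemma card_wsq_eq j : (#|[set k | wsq k == wsq j]| <= D)%N.
Proof.
apply: leq_trans (divD (k := wsq j) _); last by rewrite wsq_gt0 (leq_trans (wsq_le j)).
apply: (leq_card_size (f := fun k : J => k.2.+1)).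
  move=> [l y] [l' y']; rewrite !inE /wsq /= => /eqP <- /eqP E [yy].
  move: E; rewrite yy => /eqP; rewrite eqn_pmul2r ?expn_gt0 // eqSS => /eqP ll.
  by congr (_, _); apply: val_inj.
move=> k; rewrite inE -dvdn_divisors ?wsq_gt0 // => /eqP <-.
by rewrite /wsq dvdn_mull // expnS dvdn_mulr.
Qed.

(** The equation factors as [k = a (b - c) (b + c)]: the divisors [a] and [b - c] of [k] determine
    [b + c], hence the triple. Keeping [a], [b], [c] abstract serves both signs of
    [wsq j - wsq k]. *)
Lemma card_diff_squares (T : finType) (a b c : T -> nat) k : (0 < k <= B)%N ->
  (forall t, 0 < a t)%N ->
  injective (fun t => (a t, b t, c t)) ->
  (#|[set t | a t * b t ^ 2 == k + a t * c t ^ 2]| <= D * D)%N.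
Proof.
move=> kB a0 inj; have k0 : (0 < k)%N by case/andP: kB.
have main t : (a t * b t ^ 2 == k + a t * c t ^ 2)%N ->
    (c t < b t)%N /\ k = (a t * ((b t - c t) * (2 * c t + (b t - c t))))%N.
  move=> /eqP E; have := a0 t => at0.
  have cb : (c t < b t)%N.
    by rewrite -(ltn_exp2r _ _ (isT : 0 < 2)%N) -(ltn_pmul2l at0) E; lia.
  split => //; move: E; rewrite -{1}(subnK (ltnW cb)).
  move: (b t - c t)%N => d; rewrite sqrnD; nia.
apply: (@leq_trans (size [seq (x, y) | x <- divisors k, y <- divisors k])); last first.
  by rewrite size_allpairs leq_mul // divD.
apply: (leq_card_size (f := fun t => (a t, b t - c t)%N)).
  move=> s t; rewrite !inE => /main[cs ks] /main[ct kt] [ast dst].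
  apply: inj; move: ks; rewrite {}kt -ast -dst => /eqP.
  have d0 : (0 < b s - c s)%N by rewrite subn_gt0.
  rewrite eqn_pmul2l ?a0 // eqn_pmul2l // eqn_add2r eqn_pmul2l // => /eqP ccs.
  by congr (_, _, _) => //; lia.
move=> t; rewrite inE => /main[ct kt].
apply/allpairsP; exists (a t, b t - c t)%N; split => //.
  by rewrite -dvdn_divisors // [X in (_ %| X)%N]kt dvdn_mulr.
by rewrite -dvdn_divisors // [X in (_ %| X)%N]kt dvdn_mull // dvdn_mulr.
Qed.

(* For [wsq j <> wsq k] the equation reads [wsq j - wsq k = l (y^2 - y'^2)], so
   that [l] and [|y - y'|] are divisors of a fixed nonzero integer. *)
Lemma card_energy (j k : J) :
  (#|[set t : 'I_nL * 'I_nY * 'I_nY |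
      wsq j + wsq (t.1.1, t.2) == wsq k + wsq (t.1.1, t.1.2)]|
   <= (wsq j == wsq k) * (nL * nY) + D * D)%N.
Proof.
case: (ltngtP (wsq j) (wsq k)) => [h|h|h].
- rewrite mul0n add0n.
  apply: leq_trans (card_diff_squares (k := (wsq k - wsq j)%N)
    (a := fun t : 'I_nL * 'I_nY * 'I_nY => t.1.1.+1) (b := fun t => t.2.+1)
    (c := fun t => t.1.2.+1) _ _ _).
  + apply/subset_leq_card/fintype.subsetP => t; rewrite !inE.
    rewrite -[(_ * t.2.+1 ^ 2)%N]/(wsq (t.1.1, t.2)).
    rewrite -[(_ * t.1.2.+1 ^ 2)%N]/(wsq (t.1.1, t.1.2)).
    move: (wsq (_, t.2)) (wsq (_, t.1.2)) (wsq j) (wsq k) h => x y z w h.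
    by move=> /eqP E; apply/eqP; lia.
  + by rewrite subn_gt0 h (leq_trans (leq_subr _ _)) // (leq_trans (wsq_le _)).
  + by [].
  + by move=> [[l y] y'] [[m z] z'] /= [? ? ?]; congr (_, _, _); apply: val_inj.
- rewrite mul0n add0n.
  apply: leq_trans (card_diff_squares (k := (wsq j - wsq k)%N)
    (a := fun t : 'I_nL * 'I_nY * 'I_nY => t.1.1.+1) (b := fun t => t.1.2.+1)
    (c := fun t => t.2.+1) _ _ _).
  + apply/subset_leq_card/fintype.subsetP => t; rewrite !inE.
    rewrite -[(_ * t.2.+1 ^ 2)%N]/(wsq (t.1.1, t.2)).
    rewrite -[(_ * t.1.2.+1 ^ 2)%N]/(wsq (t.1.1, t.1.2)).
    move: (wsq (_, t.2)) (wsq (_, t.1.2)) (wsq j) (wsq k) h => x y z w h.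
    by move=> /eqP E; apply/eqP; lia.
  + by rewrite subn_gt0 h (leq_trans (leq_subr _ _)) // (leq_trans (wsq_le _)).
  + by [].
  + by move=> [[l y] y'] [[m z] z'] /= [? ? ?]; congr (_, _, _); apply: val_inj.
(* Equal weights force [y = y'], so a solution is determined by its pair [(l, y)]. *)
rewrite mul1n; apply: leq_trans (leq_addr _ _).
apply: (@leq_trans #|[set: J]|); last by rewrite cardsT card_prod !card_ord.
rewrite [leqRHS]cardE; apply: (leq_card_size (f := fun t : 'I_nL * 'I_nY * 'I_nY => t.1)).
  move=> [[l y] y'] [[m z] z']; rewrite !inE h !eqn_add2l /wsq /=.
  rewrite !eqn_pmul2l // !eqn_exp2r // => /eqP[yy] /eqP[zz] [lm yz].
  have {}yy : y' = y := val_inj yy; have {}zz : z' = z := val_inj zz.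
  by rewrite yy zz lm yz.
by move=> t _; rewrite mem_enum inE.
Qed.

Lemma sum_wsq_eq : (\sum_(j : J) \sum_(k : J) (wsq j == wsq k) <= nL * nY * D)%N.
Proof.
apply: (@leq_trans (\sum_(j : J) D)); last by rewrite sum_nat_const card_prod !card_ord.
apply: leq_sum => j _; apply: leq_trans (card_wsq_eq j).
by rewrite -sum1dep_card [leqRHS]big_mkcond /=; apply: leq_sum => k _; rewrite eq_sym; case: eqP.
Qed.

(** The count [r(m)] for [m >= 0]; negative [m] are recovered by exchanging the two pairs. *)
Definition diff_repr n : nat := (\sum_(j : J) \sum_(k : J) (wsq j == wsq k + n))%N.

(** The function [r_l]: the subtracted pair has its first component fixed to [l]. *)
Let diff_repr1 (l : 'I_nL) n : nat :=
  (\sum_(s : J * 'I_nY) (wsq s.1 == wsq (l, s.2) + n))%N.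

Lemma diff_reprE n : diff_repr n = (\sum_l diff_repr1 l n)%N.
Proof.
rewrite /diff_repr /diff_repr1.
under [LHS]eq_bigr do rewrite big_pair.
by rewrite exchange_big; apply: eq_bigr => l _ /=; rewrite [RHS]big_pair.
Qed.

(** Opening the square counts solutions of [wsq j + l y'^2 = wsq k + l y^2]. For fixed [j] and [k]
    this is [card_energy], whose two terms sum to [m^2 D] and [m^2 D^2] with [m = nL * nY]; hence
    the factor 2. *)
Lemma sum_diff_repr1_sqr M : (\sum_(l : 'I_nL) \sum_(1 <= n < M) diff_repr1 l n ^ 2
   <= 2 * (nL * nY) ^ 2 * D ^ 2)%N.
Proof.
have [Z|L0] := posnP (nL * nY)%N.
  rewrite big1 // => l _; rewrite big1 // => n _; rewrite /diff_repr1 big_pred0 //.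
  move=> [[i y] y']; exfalso.
  by move/eqP: Z; rewrite muln_eq0; case/orP => /eqP Z; [case: (i) | case: (y)];
    rewrite Z.
(* Needed to absorb [D] into [D ^ 2] at the end. *)
have D0 : (0 < D)%N.
  apply: leq_trans (divD (k := 1) _) => //.
  by move: MB L0; rewrite expnS; nia.
apply: (@leq_trans (\sum_(j : J) \sum_(k : J)
  #|[set t : 'I_nL * 'I_nY * 'I_nY |
      wsq j + wsq (t.1.1, t.2) == wsq k + wsq (t.1.1, t.1.2)]|)%N).
  have step l : (\sum_(1 <= n < M) diff_repr1 l n ^ 2 <=
    \sum_(s : J * 'I_nY) \sum_(t : J * 'I_nY)
      (wsq s.1 + wsq (l, t.2) == wsq t.1 + wsq (l, s.2)))%N.
    under eq_bigr do rewrite expnS expn1 /diff_repr1 big_distrlr /=.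
    rewrite exchange_big; apply: leq_sum => s _ /=.
    rewrite exchange_big; apply: leq_sum => t _ /=.
    set x := wsq s.1; set y := wsq (l, s.2); set z := wsq t.1; set w := wsq (l, t.2).
    (* At most one [n] satisfies both [x = y + n] and [z = w + n], and eliminating it leaves
       [x + w = z + y]. *)
    apply: (@leq_trans (\sum_(1 <= n < M | n == x - y) (x + w == z + y))%N).
      rewrite [leqRHS]big_mkcond; apply: leq_sum => n _.
      by case: (eqVneq n (x - y)%N); case: eqP; case: eqP; case: eqP => //=; lia.
    rewrite -big_filter; case: eqP => _; last by rewrite big1.
    rewrite sum1_size size_filter count_uniq_mem ?iota_uniq //; exact: leq_b1.
  apply: leq_trans (leq_sum _ (fun l _ => step l)) _.
  rewrite leq_eqVlt; apply/orP; left; apply/eqP.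
  transitivity (\sum_(l : 'I_nL) \sum_(j : J) \sum_(k : J) \sum_(y : 'I_nY) \sum_(y' : 'I_nY)
     (wsq j + wsq (l, y') == wsq k + wsq (l, y)))%N.
    apply: eq_bigr => l _.
    rewrite big_pair; apply: eq_bigr => j _.
    under eq_bigr do rewrite big_pair.
    by rewrite exchange_big.
  rewrite exchange_big; apply: eq_bigr => j _ /=.
  rewrite exchange_big; apply: eq_bigr => k _ /=.
  rewrite -sum1dep_card [RHS]big_mkcond /=.
  rewrite [RHS]big_pair [RHS]big_pair /=.
  apply: eq_bigr => l _; apply: eq_bigr => y _; apply: eq_bigr => y' _.
  by case: eqP.
apply: (@leq_trans (\sum_(j : J) \sum_(k : J)
   ((wsq j == wsq k) * (nL * nY) + D * D))%N).
  by apply: leq_sum => j _; apply: leq_sum => k _; exact: card_energy.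
under eq_bigr do rewrite big_split -big_distrl /=.
rewrite big_split -big_distrl /= !sum_nat_const card_prod !card_ord.
have := sum_wsq_eq; rewrite !expnS !expn0 !muln1.
move: (\sum_j _)%N (nL * nY)%N L0 => S m m0 SD; nia.
Qed.

(* Splitting off only one of the two variables [l] keeps the bound at
   [nL^3 nY^2], the square of the mean value [nL] of [diff_repr] times the
   length [nL nY^2] of its support. *)
Lemma sum_diff_repr_sqr (R : realType) M :
  \sum_(1 <= n < M) (diff_repr n)%:R ^+ 2 <=
  nL%:R * (2 * (nL * nY)%:R ^+ 2 * D%:R ^+ 2) :> R.
Proof.
apply: (@le_trans _ _ (\sum_(1 <= n < M) nL%:R * (\sum_l (diff_repr1 l n)%:R ^+ 2))).
  apply: ler_sum => n _; rewrite diff_reprE natr_sum.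
  have := cauchy_schwarz (index_enum 'I_nL) xpredT (fun=> 1 : R) (fun l => (diff_repr1 l n)%:R).
  under [X in X ^+ 2]eq_bigr do rewrite mul1r.
  under [X in _ <= X * _]eq_bigr do rewrite expr1n.
  by rewrite sumr_const card_ord.
rewrite -mulr_sumr ler_wpM2l // exchange_big /=.
have := sum_diff_repr1_sqr M; rewrite -(ler_nat R) natr_sum.
have -> : (2 * (nL * nY) ^ 2 * D ^ 2)%N%:R = 2 * (nL * nY)%:R ^+ 2 * D%:R ^+ 2 :> R.
  by rewrite natrM natrX [(2 * _)%:R]natrM natrX.
apply: le_trans; apply: ler_sum => l _; rewrite natr_sum.
by apply: ler_sum => n _; rewrite natrX.
Qed.

End Counting.

(** * Geometric bounds summed over residues modulo [q] *)

Section ResidueSums.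
Variables (R : realType) (a : int) (q X : nat).
Hypotheses (q0 : (0 < q)%N) (aq : coprime `|a|%N q).
Let H : R := \sum_(1 <= r < q.+1) r%:R^-1.
Let G (k : nat) : R := geometric_bound R q X (a * k%:Z).

Let G_ge0 k : 0 <= G k. Proof. exact: geometric_bound_ge0. Qed.

Let G_period k b : G (b * q + k) = G k.
Proof.
by rewrite /G /geometric_bound PoszD PoszM mulrDr mulrA modzMDl.
Qed.

Lemma sum_geometric_bound_residues : \sum_(r < q) geometric_bound R q X r%:Z <= X%:R + 2 * q%:R * H.
Proof.
have qR : (0 : R) < q%:R by rewrite ltr0n.
rewrite -(big_mkord xpredT (fun r => geometric_bound R q X r%:Z)) big_ltn //.
rewrite /geometric_bound mod0z eqxx lerD2l.
(* Partial fractions: [q^2 / (r (q - r)) = q / r + q / (q - r)]; the reflection [r -> q - r] then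
   identifies the two sums. *)
have -> : \sum_(1 <= r < q) (if (r %% q)%Z == 0 then X%:R else
    q%:R ^+ 2 / ((r %% q)%Z%:~R * (q%:R - (r %% q)%Z%:~R))) =
  \sum_(1 <= r < q) q%:R * r%:R^-1 + \sum_(1 <= r < q) q%:R * (q - r)%:R^-1 :> R.
  rewrite -big_split; apply: eq_big_nat => r /andP[r1 rq].
  rewrite modz_nat modn_small // eqz_nat eqn0Ngt r1 /= natrB 1?ltnW //.
  rewrite -[r%:~R]/(r%:R); field.
  by rewrite !gt_eqF // ?subr_gt0 ?ltr_nat ?ltr0n.
have -> : \sum_(1 <= r < q) q%:R * (q - r)%:R^-1 = \sum_(1 <= r < q) q%:R * r%:R^-1 :> R.
  rewrite big_nat_rev; apply: eq_big_nat => r /andP[r1 rq].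
  by congr (_ * _%:R^-1); lia.
have SH : \sum_(1 <= r < q) r%:R^-1 <= H by rewrite /H big_nat_recr //= lerDl invr_ge0.
by rewrite -mulr_sumr; have := ler_wpM2l (ltW qR) SH; lra.
Qed.

(** Multiplication by [a], which is coprime to [q], permutes the residues; [b] is the nonnegative
    residue of [a]. *)
Lemma sum_geometric_bound_period : \sum_(k < q) G k <= X%:R + 2 * q%:R * H.
Proof.
apply: le_trans sum_geometric_bound_residues.
set b := `|(a %% q)%Z|%N.
have bE : b%:Z = (a %% q)%Z by rewrite gez0_abs // modz_ge0 // lt0n_neq0.
have bq : coprime b q.
  by rewrite -[coprime b q]/(coprimez b q) bE /coprimez gcdz_modl.
pose f (k : 'I_q) := Ordinal (ltn_pmod (b * k) q0).
have finj : injective f.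
  move=> i j [/eqP E]; apply: val_inj => /=.
  wlog ij : i j E / (i <= j)%N.
    by move=> W; case/orP: (leq_total i j) => [|/W<-] //; [exact: W | rewrite eq_sym].
  move: E; rewrite eq_sym eqn_mod_dvd ?leq_mul // -mulnBr Gauss_dvdr 1?coprime_sym //.
  by have := ltn_ord j; case: (posnP (j - i)) => [|d0 jq /(dvdn_leq d0)]; lia.
rewrite [leRHS](reindex_inj finj) /= le_eqVlt; apply/orP; left; apply/eqP.
apply: eq_bigr => k _; rewrite /G /geometric_bound.
have -> : ((b * k %% q)%N %% q)%Z = (a * k %% q)%Z.
  by rewrite -modz_nat PoszM bE modz_mod modzMml.
by [].
Qed.

Lemma sum_geometric_bound_le K : \sum_(0 <= k < K) G k <= (K%:R / q%:R + 1) * (X%:R + 2 * q%:R * H).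
Proof.
have qR : (0 : R) < q%:R by rewrite ltr0n.
have blocks b : \sum_(0 <= k < b * q) G k <= b%:R * (X%:R + 2 * q%:R * H).
  elim: b => [|b IH]; first by rewrite mul0n big_geq // mul0r.
  rewrite (@big_cat_nat _ _ _ (b * q)) //=; last by rewrite leq_mul2r leqnSn orbT.
  rewrite -natr1 mulrDl mul1r; apply: lerD IH _.
  apply: le_trans sum_geometric_bound_period.
  rewrite -{1}[(b * q)%N]add0n big_addn mulSn addnK big_mkord.
  by under eq_bigr do rewrite addnC G_period.
have H0 : 0 <= X%:R + 2 * q%:R * H.
  rewrite addr_ge0 // !mulr_ge0 //; apply: sumr_ge0 => r _; by rewrite invr_ge0.
apply: (@le_trans _ _ (\sum_(0 <= k < (K %/ q).+1 * q) G k)).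
  rewrite [leRHS](@big_cat_nat _ _ _ K) //=; last by rewrite ltnW // ltn_ceil.
  by rewrite lerDl sumr_ge0.
apply: le_trans (blocks _) _; rewrite ler_wpM2r // -natr1 lerD2r.
by rewrite ler_pdivlMr // -natrM ler_nat leq_trunc_div.
Qed.

(** The pair [(n, h)] enters only through [k = 2 h n], which arises at most [D] times. This leaves a
    sum over consecutive [k], made of at most [(2 X M + 1) / q + 1] periods. *)
Lemma sum_weyl_le (B D M : nat) :
  (forall k, (0 < k <= B)%N -> (size (divisors k) <= D)%N) ->
  (2 * X * M <= B)%N ->
  \sum_(1 <= n < M.+1) (X%:R + 2 * \sum_(1 <= h < X) geometric_bound R q X (2 * h%:Z * (a * n%:Z)))
  <= M%:R * X%:R + 2 * D%:R * ((2 * X * M + 1)%:R / q%:R + 1) * (X%:R + 2 * q%:R * H).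
Proof.
move=> divD XMB; rewrite big_split /=; apply: lerD.
  by rewrite sumr_const_nat subn1 /= -[leLHS]mulr_natl.
rewrite -mulr_sumr -!mulrA ler_wpM2l // !mulrA -mulrA.
apply: le_trans (ler_wpM2l _ (sum_geometric_bound_le (2 * X * M + 1))) => //.
apply: (@le_trans _ _ (\sum_(t : 'I_M * 'I_X) G (2 * t.2.+1 * t.1.+1))).
  rewrite big_pair /= big_add1 big_mkord; apply: ler_sum => n _.
  rewrite big_add1 -(big_mkord xpredT (fun h => G (2 * h.+1 * n.+1))).
  (* Differencing has [h < X], whereas successors of ['I_X] reach [X]; the extra term is
     nonnegative. *)
  rewrite [leRHS](@big_cat_nat _ _ _ X.-1) ?leq_pred //=.
  rewrite -[leLHS]addr0 lerD ?sumr_ge0 // le_eqVlt; apply/orP; left; apply/eqP.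
  by apply: eq_bigr => h _; rewrite /G !PoszM; congr geometric_bound; ring.
apply: (sum_fiber_le (f := fun t : 'I_M * 'I_X => (2 * t.2.+1 * t.1.+1)%N)) => //.
  by move=> t; rewrite addn1 ltnS leq_mul // leq_mul.
move=> t; set k := (2 * _ * _)%N.
have k0 : (0 < k)%N by rewrite /k !muln_gt0.
have kB : (k <= B)%N by apply: leq_trans XMB; rewrite leq_mul // leq_mul.
apply: leq_trans (divD k _); last by rewrite k0.
apply: (leq_card_size (f := fun s : 'I_M * 'I_X => s.2.+1)).
  move=> [n h] [n' h']; rewrite !inE /= => /eqP <- /eqP E [hh].
  move: E; rewrite hh => /eqP; rewrite eqn_pmul2l ?muln_gt0 // eqSS => /eqP nn.
  by congr (_, _); apply: val_inj.
move=> s; rewrite inE -dvdn_divisors // => /eqP <-.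
by rewrite dvdn_mulr // dvdn_mull.
Qed.

End ResidueSums.

(** * The trilinear sum *)

(** Pairs are sorted by the sign of [wsq j - wsq k]. Equal weights get the trivial bound [X]; the
    symmetry of [T] folds negative differences onto positive ones, hence the factor 2. *)
Lemma sum_by_difference (R : realType) (nL nY : nat)
    (T : 'I_nL * 'I_nY -> 'I_nL * 'I_nY -> R) (X : R) (s : nat -> R) :
  (forall j k, T j k = T k j) -> (forall j k, T j k <= X) -> (forall n, 0 <= s n) ->
  (forall j k n, wsq j = (wsq k + n)%N -> T j k <= s n) -> 0 <= X ->
  \sum_j \sum_k T j k <=
    X * (\sum_(j : 'I_nL * 'I_nY) \sum_(k : 'I_nL * 'I_nY) (wsq j == wsq k))%N%:R
    + 2 * \sum_(1 <= n < (nL * nY ^ 2).+1) (diff_repr nL nY n)%:R * s n.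
Proof.
move=> Tsym TX s0 Ts X0; set M := (nL * nY ^ 2)%N.
have step j k : T j k <= X * (wsq j == wsq k)%:R +
  \sum_(1 <= n < M.+1) (wsq j == wsq k + n)%N%:R * s n +
  \sum_(1 <= n < M.+1) (wsq k == wsq j + n)%N%:R * s n.
  have S0 (i i' : 'I_nL * 'I_nY) :
      0 <= \sum_(1 <= n < M.+1) (wsq i == wsq i' + n)%N%:R * s n.
    by apply: sumr_ge0 => n _; rewrite mulr_ge0.
  have S1 (i i' : 'I_nL * 'I_nY) : (wsq i' < wsq i)%N ->
      s (wsq i - wsq i')%N <= \sum_(1 <= n < M.+1) (wsq i == wsq i' + n)%N%:R * s n.
    move=> h; rewrite (bigD1_seq (wsq i - wsq i')%N) ?iota_uniq //=; last first.
      by rewrite mem_index_iota subn_gt0 h ltnS (leq_trans (leq_subr _ _)) // wsq_le.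
    rewrite subnKC ?(ltnW h) // eqxx mul1r lerDl.
    by apply: sumr_ge0 => n _; rewrite mulr_ge0.
  case: (ltngtP (wsq j) (wsq k)) => [h|h|h].
  - rewrite mulr0 add0r -[leLHS]add0r; apply: lerD; first exact: S0.
    by rewrite Tsym; apply: le_trans (S1 _ _ h); apply: Ts; rewrite subnKC // ltnW.
  - rewrite mulr0 add0r -[leLHS]addr0; apply: lerD; last exact: S0.
    by apply: le_trans (S1 _ _ h); apply: Ts; rewrite subnKC // ltnW.
  by rewrite mulr1 -addrA; apply: le_trans (TX j k) _; rewrite lerDl addr_ge0 ?S0.
apply: (@le_trans _ _ (\sum_j \sum_k (X * (wsq j == wsq k)%:R +
  \sum_(1 <= n < M.+1) (wsq j == wsq k + n)%N%:R * s n +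
  \sum_(1 <= n < M.+1) (wsq k == wsq j + n)%N%:R * s n))).
  by apply: ler_sum => j _; apply: ler_sum => k _.
have E : \sum_(j : 'I_nL * 'I_nY) \sum_(k : 'I_nL * 'I_nY)
    \sum_(1 <= n < M.+1) (wsq j == wsq k + n)%N%:R * s n =
    \sum_(1 <= n < M.+1) (diff_repr nL nY n)%:R * s n.
  under eq_bigr do rewrite exchange_big.
  rewrite exchange_big; apply: eq_bigr => n _ /=.
  rewrite /diff_repr natr_sum mulr_suml; apply: eq_bigr => j _.
  by rewrite natr_sum mulr_suml.
rewrite le_eqVlt; apply/orP; left; apply/eqP.
under eq_bigr do rewrite !big_split /= -mulr_sumr -natr_sum.
rewrite !big_split /= -mulr_sumr -natr_sum E.
by rewrite [X in _ + X = _]exchange_big /= E -addrA -mulr2n mulr_natl.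
Qed.

Lemma interval_convex (R : realType) (i : interval R) (x y z : R) :
  x \in i -> z \in i -> x <= y <= z -> y \in i.
Proof.
case: i => l r; rewrite !itv_boundlr => /andP[lx xr] /andP[lz zr] /andP[xy yz].
apply/andP; split.
  by apply: le_trans lx _; rewrite bnd_simp.
by apply: le_trans zr; rewrite bnd_simp.
Qed.

(** * The trilinear sum with independent ranges *)

Section Core.
Variables (R : realType) (a : int) (q nL nY nX B D : nat) (beta gamma : R).
Variables (c u b : nat -> R[i]) (I : nat -> interval R).
Hypotheses (q0 : (0 < q)%N) (aq : coprime `|a|%N q).
Hypothesis divD : forall k, (0 < k <= B)%N -> (size (divisors k) <= D)%N.
Hypothesis MB : (nL * nY ^ 2 <= B)%N.
Hypothesis XMB : (2 * nX * (nL * nY ^ 2) <= B)%N.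
Hypotheses (c1 : forall l, nrm (c l) <= 1) (u1 : forall x, nrm (u x) <= 1)
  (b1 : forall y, nrm (b y) <= 1).
Let J := ('I_nL * 'I_nY)%type.
Let H : R := \sum_(1 <= r < q.+1) r%:R^-1.

(** This is [kappa(m)]. It bounds the square of an inner sum, so the sum itself is compared with its
    root, and Cauchy-Schwarz over [n] restores the first power. *)
Definition weyl_bound (n : nat) : R :=
  nX%:R + 2 * \sum_(1 <= h < nX) geometric_bound R q nX (2 * h%:Z * (a * n%:Z)).

Lemma weyl_bound_ge0 n : 0 <= weyl_bound n.
Proof.
rewrite /weyl_bound addr_ge0 // mulr_ge0 // sumr_ge0 // => h _; exact: geometric_bound_ge0.
Qed.

(** The interval condition is encoded by the value 0, so that [t] has the same range for all [j]. *)
Let f (j : J) (t : 'I_nX) : R[i] :=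
  c j.1.+1 * b j.2.+1 * (if t.+1%:R \in I j.2.+1 then
     e (j.1.+1%:R * g a q beta gamma (t.+1 * j.2.+1)%:R) else 0).

Let T (j k : J) : R := nrm (\sum_t f j t * (f k t)^*).

Let T_split (j k : J) : T j k <=
  nrm (\sum_(t < nX | (t.+1%:R \in I j.2.+1) && (t.+1%:R \in I k.2.+1))
    e (j.1.+1%:R * g a q beta gamma (t.+1 * j.2.+1)%:R
       - k.1.+1%:R * g a q beta gamma (t.+1 * k.2.+1)%:R)).
Proof.
rewrite /T.
set w := (c j.1.+1 * b j.2.+1) * (c k.1.+1 * b k.2.+1)^*.
have w1 : nrm w <= 1.
  by rewrite /w nrmM nrm_conj !nrmM !mulr_ile1 ?mulr_ge0 ?nrm_ge0.
have -> : \sum_t f j t * (f k t)^* = w *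
  \sum_(t < nX | (t.+1%:R \in I j.2.+1) && (t.+1%:R \in I k.2.+1))
    e (j.1.+1%:R * g a q beta gamma (t.+1 * j.2.+1)%:R
       - k.1.+1%:R * g a q beta gamma (t.+1 * k.2.+1)%:R).
  rewrite [in RHS]big_mkcond mulr_sumr; apply: eq_bigr => t _.
  rewrite /f rmorphM mulrACA -/w; congr (_ * _).
  case: ifP => _ /=; last by rewrite mul0r.
  case: ifP => _; last by rewrite rmorph0 mulr0.
  by rewrite conj_e eD.
by rewrite nrmM ler_piMl ?nrm_ge0.
Qed.

Let T_sym j k : T j k = T k j.
Proof.
rewrite /T -nrm_conj rmorph_sum; congr nrm; apply: eq_bigr => t _.
by rewrite rmorphM /= conjCK mulrC.
Qed.

Let T_triv j k : T j k <= nX%:R.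
Proof.
apply: le_trans (T_split j k) _; apply: le_trans (nrm_sum _ _ _) _.
rewrite big_mkcond -[X in _ <= X%:R](card_ord nX) -sumr_const; apply: ler_sum => t _.
by case: ifP => _; rewrite ?nrm_e.
Qed.

Let T_weyl j k n : wsq j = (wsq k + n)%N -> T j k <= Num.sqrt (weyl_bound n).
Proof.
move=> E; apply: le_trans (T_split j k) _.
rewrite -[leLHS]ger0_norm ?nrm_ge0 // -sqrtr_sqr ler_sqrt ?weyl_bound_ge0 //.
(* [Bt] and [Dt] are the linear and constant coefficients in [x] of [l g(x y) - l' g(x y')]; by [E]
   the leading one is [a n / q]. *)
set Bt := beta * (j.1.+1%:R * j.2.+1%:R - k.1.+1%:R * k.2.+1%:R).
set Dt := gamma * (j.1.+1%:R - k.1.+1%:R).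
pose P t := (t.+1%:R \in I j.2.+1) && (t.+1%:R \in I k.2.+1).
have Pconv i i' k' : P i -> P k' -> (i <= i' <= k')%N -> P i'.
  move=> /andP[ij ik] /andP[kj kk] ii.
  have h : i.+1%:R <= (i'.+1%:R : R) <= k'.+1%:R by rewrite !ler_nat !ltnS.
  by rewrite /P (interval_convex ij kj h) (interval_convex ik kk h).
have := nrm_quadratic_sum_convex nX (a * n%:Z) Bt Dt q0 Pconv.
apply: le_trans; rewrite le_eqVlt; apply/orP; left; apply/eqP.
congr (nrm _ ^+ 2); apply: eq_bigr => t _; congr e.
have En : (a * n%:Z)%:~R = a%:~R * (j.1.+1%:R * j.2.+1%:R ^+ 2 - k.1.+1%:R * k.2.+1%:R ^+ 2) :> R.
  rewrite intrM; congr (_ * _); rewrite -!natrX -!natrM.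
  by rewrite -/(wsq j) -/(wsq k) E natrD addrC addKr.
rewrite En /g /Bt /Dt !natrM; ring.
Qed.

Lemma trilinear_core :
  nrm (\sum_(l < nL) c l.+1 * \sum_(y < nY) b y.+1 *
     \sum_(t < nX | t.+1%:R \in I y.+1)
        u t.+1 * e (l.+1%:R * g a q beta gamma (t.+1 * y.+1)%:R)) ^+ 2 <=
  nX%:R * (nX%:R * (nL * nY * D)%:R + 2 * Num.sqrt (
     (nL%:R * (2 * (nL * nY)%:R ^+ 2 * D%:R ^+ 2)) *
     ((nL * nY ^ 2)%:R * nX%:R + 2 * D%:R * ((2 * nX * (nL * nY ^ 2) + 1)%:R / q%:R + 1)
       * (nX%:R + 2 * q%:R * H)))).
Proof.
have -> : \sum_(l < nL) c l.+1 * \sum_(y < nY) b y.+1 *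
     \sum_(t < nX | t.+1%:R \in I y.+1)
        u t.+1 * e (l.+1%:R * g a q beta gamma (t.+1 * y.+1)%:R) =
     \sum_(t < nX) u t.+1 * \sum_j f j t.
  under [RHS]eq_bigr do rewrite mulr_sumr.
  rewrite [RHS]exchange_big big_pair /=; apply: eq_bigr => l _.
  rewrite mulr_sumr; apply: eq_bigr => y _.
  rewrite big_mkcond !mulr_sumr; apply: eq_bigr => t _ /=.
  rewrite /f /=; case: ifP => _; last by rewrite !mulr0.
  by ring.
apply: le_trans (sqr_trilinear_le _ _) _ => //.
rewrite card_ord ler_wpM2l //.
apply: le_trans (sum_by_difference T_sym T_triv (fun n => sqrtr_ge0 _) T_weyl _) _ => //.
apply: lerD; first by rewrite ler_wpM2l // ler_nat; exact: sum_wsq_eq divD MB.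
rewrite ler_wpM2l //.
set S := \sum_(1 <= n < _) _.
have S0 : 0 <= S by apply: sumr_ge0 => n _; rewrite mulr_ge0 ?sqrtr_ge0.
rewrite -[leLHS]ger0_norm // -sqrtr_sqr; apply: ler_wsqrtr.
apply: le_trans (cauchy_schwarz _ _ _ _) _.
apply: ler_pM; [by apply: sumr_ge0 => n _; rewrite sqr_ge0 .. | |].
  exact: sum_diff_repr_sqr divD MB R _.
under eq_bigr do rewrite sqr_sqrtr ?weyl_bound_ge0 //.
exact: sum_weyl_le divD XMB.
Qed.

End Core.

(** The first term of the bound comes from equal weights, the second from the root. Inside the root
    every part of the Weyl sum is compared with [Z = L N Y], the order of magnitude of
    [nL * nY ^ 2 * nX]. *)
Lemma core_bound_le (R : realType) (nL nY nX D H L Y N d h K q : R) :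
  0 <= nL <= L -> 0 <= nY <= 2 * Y -> 0 <= nX <= N / Y -> 0 <= D <= d -> 0 <= H <= h ->
  1 <= K -> 1 <= d -> 1 <= h -> 1 <= L -> 1 <= N -> 0 < Y -> 1 <= K * Y ->
  N <= K * q -> q <= 2 * K * L * N ->
  nX * (nX * (nL * nY * D) + 2 * Num.sqrt ((nL * (2 * (nL * nY) ^+ 2 * D ^+ 2)) *
     (nL * nY ^+ 2 * nX + 2 * D * ((2 * nX * (nL * nY ^+ 2) + 1) / q + 1)
       * (nX + 2 * q * H))))
  <= 2 * d * N ^+ 2 * (L / Y) + 48 * K ^+ 2 * (d * h) ^+ 2 * N * (L ^+ 2 * Num.sqrt (N * Y)).
Proof.
move=> /andP[nL0 nLL] /andP[nY0 nYY] /andP[nX0 nXX] /andP[D0 Dd] /andP[H0 Hh].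
move=> K1 d1 h1 L1 N1 Y0 KY NKq qKLN.
have [K0 [d0 [h0 [L0 N0]]]] : 0 < K /\ 0 < d /\ 0 < h /\ 0 < L /\ 0 < N.
  by do !split; apply: lt_le_trans ltr01 _.
have q0 : 0 < q by rewrite -(pmulr_rgt0 _ K0); apply: lt_le_trans NKq.
have [X XE] : exists X, X = N / Y by exists (N / Y).
rewrite -XE in nXX; have X0 : 0 < X by rewrite XE divr_gt0.
have XY : X * Y = N by rewrite XE mulfVK ?gt_eqF.
have [Z ZE] : exists Z, Z = L * N * Y by exists (L * N * Y).
have Z0 : 0 < Z by rewrite ZE !mulr_gt0.
have LNZ : L * N <= K * Z.
  rewrite ZE; have : 0 <= L * N by rewrite mulr_ge0 ?ltW.
  by move: (L * N) => w w0; nra.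
have NLN : N <= L * N by rewrite ler_peMl // ltW.
have oneKZ : 1 <= K * Z by exact: le_trans N1 (le_trans NLN LNZ).
have XZ : X <= K ^+ 2 * Z.
  rewrite XE ler_pdivrMr // (_ : K ^+ 2 * Z * Y = K * Z * (K * Y)); last by ring.
  apply: le_trans (le_trans NLN LNZ) _.
  by rewrite ler_peMr // mulr_ge0 ?(ltW K0) ?(ltW Z0).
have qZ : q <= 2 * K ^+ 2 * Z.
  apply: le_trans qKLN _; rewrite (_ : 2 * K ^+ 2 * Z = 2 * (K * (K * Z))); last by ring.
  rewrite (_ : 2 * K * L * N = 2 * (K * (L * N))); last by ring.
  by rewrite ler_wpM2l // ler_wpM2l // ltW.
have MX : nL * nY ^+ 2 * nX <= 4 * Z.
  have -> : 4 * Z = L * (2 * Y) ^+ 2 * X by rewrite ZE -XY; ring.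
  by rewrite !ler_pM ?mulr_ge0 ?exprn_ge0 // lerXn2r ?nnegrE // (le_trans nY0).
(* Since [Z X = L N^2], this is where the lower bound for [q] is used. *)
have ZXq : Z * X / q <= K ^+ 2 * Z.
  have -> : Z * X = L * N * N by rewrite ZE -XY; ring.
  rewrite ler_pdivrMr //.
  have : 0 <= L * N by rewrite mulr_ge0 ?ltW.
  move: (L * N) LNZ => w wZ w0.
  apply: (@le_trans _ _ (K * Z * (K * q))); first by apply: ler_pM => //; exact: ltW.
  by rewrite le_eqVlt; apply/orP; left; apply/eqP; ring.
have A1 : (2 * nX * (nL * nY ^+ 2) + 1) / q + 1 <= 9 * K * Z / q + 1.
  rewrite lerD2r ler_wpM2r ?invr_ge0 ?(ltW q0) //.
  have : Z <= K * Z by rewrite ler_peMl // ltW.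
  have -> : 2 * nX * (nL * nY ^+ 2) = 2 * (nL * nY ^+ 2 * nX) by ring.
  by move: MX oneKZ; lra.
have A2 : nX + 2 * q * H <= X + 2 * q * h.
  by rewrite lerD // ler_wpM2l // mulr_ge0 ?ltW.
(* Here [32 = 9 + 18 + 1 + 4], one summand for each term of the expanded product. *)
have A3 : (9 * K * Z / q + 1) * (X + 2 * q * h) <= 32 * K ^+ 3 * Z * h.
  have -> : (9 * K * Z / q + 1) * (X + 2 * q * h) =
     9 * K * (Z * X / q) + 18 * K * Z * h + X + 2 * q * h by field; rewrite gt_eqF.
  have B1 : 9 * K * (Z * X / q) <= 9 * K ^+ 3 * Z * h.
    apply: (@le_trans _ _ (9 * K * (K ^+ 2 * Z))); first by rewrite ler_wpM2l // mulr_ge0 // ltW.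
    rewrite (_ : 9 * K * (K ^+ 2 * Z) = 9 * K ^+ 3 * Z); last by ring.
    by rewrite ler_peMr // !mulr_ge0 ?exprn_ge0 ?(ltW K0) ?(ltW Z0) ?(ltW L0) ?(ltW h0) ?(ltW Y0).
  have K13 : K <= K ^+ 3 by rewrite -{1}[K]expr1 ler_weXn2l.
  have K23 : K ^+ 2 <= K ^+ 3 by rewrite ler_weXn2l.
  have Zh : 0 <= Z * h by rewrite mulr_ge0 ?ltW.
  have B2 : 18 * K * Z * h <= 18 * K ^+ 3 * Z * h.
    by rewrite ler_wpM2r ?(ltW h0) // ler_wpM2r ?(ltW Z0) // ler_wpM2l.
  have B3 : X <= K ^+ 3 * Z * h.
    apply: le_trans XZ _; apply: (@le_trans _ _ (K ^+ 3 * Z)).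
      by rewrite ler_wpM2r // ltW.
    by rewrite ler_peMr // mulr_ge0 ?exprn_ge0 ?(ltW K0) ?(ltW Z0) ?(ltW L0) ?(ltW h0) ?(ltW Y0).
  have B4 : 2 * q * h <= 4 * K ^+ 3 * Z * h.
    rewrite ler_wpM2r ?(ltW h0) //.
    apply: (@le_trans _ _ (4 * (K ^+ 2 * Z))); first by move: qZ; lra.
    by rewrite mulrA ler_wpM2r ?(ltW Z0) // ler_wpM2l.
  by move: B1 B2 B3 B4; lra.
set F1 := nL * (2 * (nL * nY) ^+ 2 * D ^+ 2).
set F2 := _ + 2 * D * _ * _.
have F1b : F1 <= 8 * L ^+ 3 * Y ^+ 2 * d ^+ 2.
  have -> : 8 * L ^+ 3 * Y ^+ 2 * d ^+ 2 = L * (2 * (L * (2 * Y)) ^+ 2 * d ^+ 2) by ring.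
  rewrite /F1 ler_pM ?mulr_ge0 ?exprn_ge0 ?mulr_ge0 //.
  rewrite ler_pM ?mulr_ge0 ?exprn_ge0 ?mulr_ge0 //; last by rewrite lerXn2r ?nnegrE // ltW.
  rewrite ler_wpM2l // lerXn2r ?nnegrE ?mulr_ge0 ?(ltW L0) ?(ltW Y0) //.
  by rewrite ler_pM.
have F2b : F2 <= 68 * K ^+ 3 * d * h * Z.
  have E1 : 2 * D * ((2 * nX * (nL * nY ^+ 2) + 1) / q + 1) * (nX + 2 * q * H) <=
     64 * K ^+ 3 * d * h * Z.
    apply: (@le_trans _ _ (2 * d * (32 * K ^+ 3 * Z * h))); last first.
      by rewrite le_eqVlt; apply/orP; left; apply/eqP; ring.
    rewrite -[leLHS]mulrA ler_pM ?mulr_ge0 ?addr_ge0 ?mulr_ge0 ?exprn_ge0 ?invr_ge0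
      ?addr_ge0 ?mulr_ge0 ?exprn_ge0 ?(ltW q0) //.
      by rewrite ler_wpM2l.
    apply: le_trans A3; apply: ler_pM => //.
    by rewrite addr_ge0 ?mulr_ge0 ?addr_ge0 ?mulr_ge0 ?exprn_ge0 ?invr_ge0 ?(ltW q0).
    by rewrite addr_ge0 ?mulr_ge0 ?(ltW q0).
  have E2 : 4 * Z <= 4 * K ^+ 3 * d * h * Z.
    rewrite ler_wpM2r ?(ltW Z0) // -!mulrA ler_peMr // !mulr_ege1 // exprn_ege1 //.
  by rewrite /F2; move: MX E1 E2; lra.
have F20 : 0 <= F2.
  by rewrite /F2 addr_ge0 ?mulr_ge0 ?addr_ge0 ?mulr_ge0 ?exprn_ge0 ?invr_ge0
    ?addr_ge0 ?mulr_ge0 ?exprn_ge0 ?(ltW q0).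
have F10 : 0 <= F1 by rewrite /F1 ?mulr_ge0 ?exprn_ge0 ?mulr_ge0.
(* The constants multiply to [8 * 68 = 544], rounded up to [24 ^ 2]; the exponents of [K], [d] and
   [h] are raised to 4 to obtain a perfect square. *)
have sqb : Num.sqrt (F1 * F2) <= 24 * K ^+ 2 * (d * h) ^+ 2 * (L ^+ 2 * Y * Num.sqrt (N * Y)).
  set W := 24 * _ * _ * _.
  have W0 : 0 <= W by rewrite /W !mulr_ge0 ?exprn_ge0 ?sqrtr_ge0 ?mulr_ge0 ?ltW.
  rewrite -[leRHS]ger0_norm // -sqrtr_sqr; apply: ler_wsqrtr.
  apply: le_trans (ler_pM F10 F20 F1b F2b) _.
  have -> : W ^+ 2 = 576 * K ^+ 4 * (d * h) ^+ 4 * (L ^+ 4 * Y ^+ 2 * (N * Y)).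
    by rewrite -[in RHS](@sqr_sqrtr _ (N * Y)) ?mulr_ge0 ?(ltW N0) ?(ltW Y0) // /W; ring.
  have -> : 8 * L ^+ 3 * Y ^+ 2 * d ^+ 2 * (68 * K ^+ 3 * d * h * Z) =
      544 * K ^+ 3 * (d ^+ 3 * h) * (L ^+ 4 * Y ^+ 2 * (N * Y)) by rewrite ZE; ring.
  rewrite ler_wpM2r ?mulr_ge0 ?exprn_ge0 ?(ltW L0) ?(ltW N0) ?(ltW Y0) //.
  have c : (544 : R) <= 576 by rewrite ler_nat.
  have cK : 544 * K ^+ 3 <= 576 * K ^+ 4.
    by apply: ler_pM; [exact: ler0n | exact: exprn_ge0 (ltW K0) | exact: c | exact: ler_weXn2l].
  have dh4 : d ^+ 3 * h <= (d * h) ^+ 4.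
    rewrite exprMn ler_pM ?exprn_ge0 ?(ltW d0) ?(ltW h0) ?ler_weXn2l //.
    by rewrite -{1}[h]expr1 ler_weXn2l.
  apply: ler_pM; [| | exact: cK | exact: dh4].
    exact: mulr_ge0 (ler0n _ _) (exprn_ge0 _ (ltW K0)).
  exact: mulr_ge0 (exprn_ge0 _ (ltW d0)) (ltW h0).
have -> : 2 * d * N ^+ 2 * (L / Y) + 48 * K ^+ 2 * (d * h) ^+ 2 * N * (L ^+ 2 * Num.sqrt (N * Y))
  = X * (X * (L * (2 * Y) * d) +
      2 * (24 * K ^+ 2 * (d * h) ^+ 2 * (L ^+ 2 * Y * Num.sqrt (N * Y)))).
  by rewrite XE; field; rewrite gt_eqF.
rewrite ler_pM ?addr_ge0 ?mulr_ge0 ?sqrtr_ge0 //.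
rewrite lerD ?ler_wpM2l // ler_pM ?mulr_ge0 // ler_pM ?mulr_ge0 // ler_pM //.
Qed.

(** Makes the three ranges independent: [Y < y] becomes a vanishing coefficient, and [x] may run up
    to [N / Y] because [I y] has no point beyond [N / y]. *)
Lemma trilinear_sumE (R : realType) (a : int) (q : nat) (beta gamma N rho eps Y : R)
    (c u b : nat -> R[i]) (I : nat -> interval R) :
  0 < N -> 0 < Y ->
  (forall y : nat, Y < y%:R -> y%:R <= 2 * Y ->
     {subset I y <= `]N / (2 * y%:R), N / y%:R]}) ->
  trilinear_sum a q beta gamma N rho eps Y c u b I =
  \sum_(l < Num.truncn (L N rho eps)) c l.+1 *
  \sum_(y < Num.truncn (2 * Y)) (if Y < y.+1%:R then b y.+1 else 0) *
  \sum_(t < Num.truncn (N / Y) | t.+1%:R \in I y.+1)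
     u t.+1 * e (l.+1%:R * g a q beta gamma (t.+1 * y.+1)%:R).
Proof.
move=> N0 Y0 hI; rewrite /trilinear_sum big_add1 big_mkord; apply: eq_bigr => l _.
congr (_ * _); rewrite big_add1 big_mkord big_mkcond; apply: eq_bigr => y _ /=.
case: ifP => [Yy|_]; last by rewrite mul0r.
congr (_ * _); rewrite big_add1 /=.
have y0 : (0 : R) < y.+1%:R by rewrite ltr0n.
have yY : y.+1%:R <= 2 * Y.
  by rewrite -truncn_ge_nat ?mulr_ge0 ?ltW // ltn_ord.
have trN : (Num.truncn (N / y.+1%:R) <= Num.truncn (N / Y))%N.
  by apply: le_truncn; rewrite ler_pM2l // lef_pV2 ?posrE // ltW.
rewrite -(big_mkord (fun t => t.+1%:R \in I y.+1)
  (fun t => u t.+1 * e (l.+1%:R * g a q beta gamma (t.+1 * y.+1)%:R))).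
rewrite [RHS](@big_cat_nat _ _ _ _ 0%N _ _ _ (leq0n _) trN) /=.
rewrite [X in _ = _ + X]big_nat_cond [X in _ = _ + X]big_pred0 ?addr0 // => t.
apply/negP => /andP[/andP[tn _] /(hI _ Yy yY)].
rewrite in_itv /= => /andP[_]; rewrite -truncn_ge_nat ?divr_ge0 ?ltW //.
by rewrite leqNgt ltnS tn.
Qed.

(** * Choice of the parameters and conclusion *)

Theorem theorem3 (R : realType) :
  exists2 eps0 : R, 0 < eps0 &
  forall eps : R, 0 < eps -> eps < eps0 ->
  (* K: an arbitrary implied constant for the hypotheses; C: that of the conclusion *)
  forall K : R, 0 < K ->
  exists C : R,
  forall alpha beta gamma : R, irrational alpha ->
  forall rho : R, 1 / 6 < rho -> rho < 1 / 5 ->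
  exists q0 : nat,
  forall (a : int) (q : nat), (0 < q)%N -> coprime `|a|%N q ->
    `|alpha - a%:~R / q%:R| < q%:R ^- 2 -> (q0 <= q)%N ->
  forall N : R, 0 < N ->
    Num.sqrt (L1 N rho eps) * N <= K * q%:R ->
    q%:R <= K * (Num.sqrt (L1 N rho eps) * N) ->
  forall Y : R, N `^ rho <= K * Y -> Y <= K * N `^ (1 - 4 * rho) ->
  forall c u b : nat -> R[i],
    (forall l, `|c l| <= 1) -> (forall x, `|u x| <= 1) ->
    (forall y, `|b y| <= 1) ->
  forall I : nat -> interval R,
    (forall y : nat, Y < y%:R -> y%:R <= 2 * Y ->
       {subset I y <= `]N / (2 * y%:R), N / y%:R]}) ->
  `|trilinear_sum a q beta gamma N rho eps Y c u b I|
    <= (C * N `^ (1 - 10 * eta eps))%:C.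
Proof.
(* With [eps < 1 / 4] and [rho > 1 / 6] the exponent [rho - eps / 2] is positive; the final
   comparison of exponents also uses this threshold. *)
exists (1 / 4) => // eps eps0 eps4 K' K'0.
(* The divisor and harmonic losses will total [N ^ (8 dl) = N ^ (eps / 6)], half of the saving
   [N ^ (eps / 3)]. *)
set dl := eps / 48; have dl0 : 0 < dl by rewrite divr_gt0.
have [Cd Cd0 hd] := size_divisors_bound dl0.
have [K [K1 KK']] : exists K : R, 1 <= K /\ K' <= K by exists (1 + K'); split; lra.
have K0 : 0 < K by apply: lt_le_trans K1.
(* The bases come from [B <= 12 K^2 N^2] and [q <= 2 K N^2]; the leading 1 keeps both constants at
   least 1. *)
set CD := 1 + Cd * (12 * K ^+ 2) `^ dl.
set CH := 1 + (1 + dl^-1) * (2 * K) `^ dl.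
have CD1 : 1 <= CD by rewrite lerDl mulr_ge0 ?powR_ge0 // ltW.
have CH1 : 1 <= CH by rewrite lerDl mulr_ge0 ?powR_ge0 // addr_ge0 // invr_ge0 ltW.
have CD0 : 0 < CD by apply: lt_le_trans CD1.
have CH0 : 0 < CH by apply: lt_le_trans CH1.
exists (8 * K ^+ 2 * CD * CH) => alpha beta gamma _ rho rho6 rho5.
(* This threshold gives [2 K < q], which rules out [N < 1]: there [L1 <= 4], and the upper bound for
   [q] would yield [q <= 2 K]. *)
exists (Num.truncn (2 * K)).+1 => a q q0 aq _ qK N N0 qN1' qN2' Y Y1' Y2' c u b c1 u1 b1 I hI.
have Y0 : 0 < Y by rewrite -(pmulr_rgt0 _ K'0); apply: lt_le_trans Y1'; rewrite powR_gt0.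
have qR : (0 : R) < q%:R by rewrite ltr0n.
have qN1 : Num.sqrt (L1 N rho eps) * N <= K * q%:R.
  by apply: le_trans qN1' _; rewrite ler_wpM2r // ltW.
have qN2 : q%:R <= K * (Num.sqrt (L1 N rho eps) * N).
  by apply: le_trans qN2' _; rewrite ler_wpM2r // mulr_ge0 ?sqrtr_ge0 // ltW.
have Y1 : N `^ rho <= K * Y by apply: le_trans Y1' _; rewrite ler_wpM2r // ltW.
have Y2 : Y <= K * N `^ (1 - 4 * rho).
  by apply: le_trans Y2' _; rewrite ler_wpM2r // powR_ge0.
have qK2 : 2 * K < q%:R.
  by rewrite -truncn_lt_nat // mulr_ge0 // ltW.
have sqrt_le_self (x : R) : 1 <= x -> Num.sqrt x <= x.
  move=> x1; have x0 : 0 <= x by apply: le_trans x1.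
  rewrite -[leRHS]ger0_norm // -sqrtr_sqr ler_wsqrtr //.
  by rewrite expr2 ler_peMr.
have N1 : 1 <= N.
  rewrite leNgt; apply/negP => N1.
  have Lle : L1 N rho eps <= 2 ^+ 2.
    rewrite /L1; have : N `^ (rho - eps / 2) <= 1.
      rewrite -[leRHS](powRr0 N); apply: ger_powR; first by rewrite N0 ltW.
      by clear - eps0 eps4 rho6 rho5; lra.
    by rewrite expr2; clear; lra.
  have sL : Num.sqrt (L1 N rho eps) <= 2.
    by have := ler_wsqrtr Lle; rewrite sqrtr_sqr ger0_norm.
  have : Num.sqrt (L1 N rho eps) * N <= 2.
    rewrite -[leRHS]mulr1; apply: ler_pM => //; rewrite ?sqrtr_ge0 // ltW //.
  move=> h; have := le_trans qN2 (ler_wpM2l (ltW K0) h).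
  by rewrite mulrC leNgt qK2.
have pwD x y : N `^ (x + y) = N `^ x * N `^ y.
  by rewrite powRD // (gt_eqF N0) /= implybT.
have pw0 x : 0 < N `^ x by rewrite powR_gt0.
have pwle x y : x <= y -> N `^ x <= N `^ y by move=> xy; apply: ler_powR.
have pw1 x : 0 <= x -> 1 <= N `^ x by move=> x0; rewrite -(powRr0 N) pwle.
have pwN : N `^ 1 = N by rewrite powRr1 // ltW.
have pw2 : N `^ 2 = N ^+ 2 by rewrite -[2]/(2%:R) powR_mulrn // ltW.
set Lr := L N rho eps.
have LE : Lr = N `^ (rho - eps / 3) by [].
have L1r : 1 <= Lr by rewrite LE pw1 //; clear - eps0 eps4 rho6 rho5; lra.
have LN : Lr <= N by rewrite LE -[leRHS]pwN pwle //; clear - eps0 eps4 rho6 rho5; lra.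
have L11 : 1 <= L1 N rho eps.
  rewrite /L1; have := @pw1 (rho - eps / 2) ltac:(clear - eps0 eps4 rho6 rho5; lra).
  by move: (N `^ _) => z; clear; lra.
have KY1 : 1 <= K * Y by apply: le_trans Y1; rewrite pw1 //; clear - eps0 eps4 rho6 rho5; lra.
have NKq : N <= K * q%:R.
  apply: le_trans qN1; rewrite ler_peMl ?(ltW N0) //.
  by have := ler_wsqrtr L11; rewrite sqrtr1.
have qKLN : q%:R <= 2 * K * Lr * N.
  apply: le_trans qN2 _; rewrite (_ : 2 * K * Lr * N = K * (2 * Lr * N)); last by ring.
  rewrite ler_wpM2l ?(ltW K0) // ler_wpM2r ?(ltW N0) //.
  apply: le_trans (sqrt_le_self _ L11) _; rewrite /L1 ler_wpM2l // LE pwle //.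
  by clear - eps0 eps4 rho6 rho5; lra.
set nL := Num.truncn Lr; set nY := Num.truncn (2 * Y); set nX := Num.truncn (N / Y).
have X0 : 0 < N / Y by rewrite divr_gt0.
have nLL : nL%:R <= Lr by rewrite truncn_le (le_trans _ L1r).
have nYY : nY%:R <= 2 * Y by rewrite truncn_le mulr_ge0 // ltW.
have nXX : nX%:R <= N / Y by rewrite truncn_le ltW.
(* Large enough both for the weights [wsq] and for the products [2 h n] from differencing. *)
set B := ((2 * nX + 1) * (nL * nY ^ 2))%N.
set D := Num.truncn (Cd * B%:R `^ dl).
have divD k : (0 < k <= B)%N -> (size (divisors k) <= D)%N.
  move=> /andP[k0 kB]; rewrite truncn_ge_nat; last by rewrite mulr_ge0 ?powR_ge0 // ltW.
  apply: le_trans (hd k k0) _; rewrite ler_wpM2l ?(ltW Cd0) //.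
  by rewrite ge0_ler_powR ?nnegrE ?ler_nat // ltW.
have LY : Lr * Y <= K * N.
  apply: (@le_trans _ _ (Lr * (K * N `^ (1 - 4 * rho)))).
    by rewrite ler_wpM2l // (le_trans _ L1r).
  rewrite mulrCA ler_wpM2l ?(ltW K0) // LE -pwD -[leRHS]pwN pwle //.
  by clear - eps0 eps4 rho6 rho5; lra.
have Br : B%:R <= 12 * K ^+ 2 * N ^+ 2.
  apply: (@le_trans _ _ ((2 * (N / Y) + 1) * (Lr * (2 * Y) ^+ 2))).
    have -> : B%:R = (2 * nX%:R + 1) * (nL%:R * nY%:R ^+ 2) :> R.
      by rewrite /B natrM natrD natrM [(nL * _)%:R]natrM natrX.
    apply: ler_pM => //.
    - by rewrite lerD2r ler_wpM2l.
    - by rewrite ler_pM // lerXn2r ?nnegrE // (le_trans _ nYY).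
  have -> : (2 * (N / Y) + 1) * (Lr * (2 * Y) ^+ 2) = 8 * N * (Lr * Y) + 4 * Y * (Lr * Y).
    by field; rewrite gt_eqF.
  have YKN : Y <= K * N.
    apply: le_trans Y2 _; rewrite ler_wpM2l ?(ltW K0) // -[leRHS]pwN pwle //.
    by clear - eps0 eps4 rho6 rho5; lra.
  have KN0 : 0 <= K * N by rewrite mulr_ge0 ?ltW.
  have h1 : N * (Lr * Y) <= K * N * (K * N).
    by rewrite ler_pM ?mulr_ge0 ?(ltW N0) ?(ltW Y0) ?(le_trans _ L1r) // ler_peMl ?(ltW N0).
  have h2 : Y * (Lr * Y) <= K * N * (K * N).
    by rewrite ler_pM ?mulr_ge0 ?(ltW Y0) ?(le_trans _ L1r).
  by move: h1 h2; clear; lra.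
set P := N `^ (2 * dl).
have P1 : 1 <= P by rewrite pw1 // mulr_ge0 // ltW.
have PE (k : R) : 0 <= k -> (k * N ^+ 2) `^ dl = k `^ dl * P.
  by move=> k0; rewrite powRM ?exprn_ge0 ?(ltW N0) // -pw2 -powRrM.
have Dd : D%:R <= CD * P.
  apply: (@le_trans _ _ (Cd * B%:R `^ dl)).
    by rewrite truncn_le mulr_ge0 ?powR_ge0 // ltW.
  apply: (@le_trans _ _ (Cd * (12 * K ^+ 2 * N ^+ 2) `^ dl)).
    rewrite ler_wpM2l ?(ltW Cd0) // ge0_ler_powR ?nnegrE ?(ltW dl0) //.
    by rewrite !mulr_ge0 ?exprn_ge0 ?ltW.
  rewrite PE ?mulr_ge0 ?exprn_ge0 ?(ltW K0) // mulrA ler_wpM2r ?(le_trans _ P1) //.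
  by rewrite lerDr.
have qN2K : q%:R <= 2 * K * N ^+ 2.
  apply: le_trans qKLN _; rewrite expr2 mulrA ler_wpM2r ?(ltW N0) //.
  by rewrite ler_wpM2l // mulr_ge0 // ltW.
set H := \sum_(1 <= r < q.+1) r%:R^-1 : R.
have Hh : H <= CH * P.
  apply: le_trans (harmonic_bound dl0 q0) _.
  apply: (@le_trans _ _ ((1 + dl^-1) * (2 * K * N ^+ 2) `^ dl)).
    rewrite ler_wpM2l ?addr_ge0 ?invr_ge0 ?(ltW dl0) //.
    by rewrite ge0_ler_powR ?nnegrE ?(ltW dl0) ?(ltW qR) // !mulr_ge0 ?exprn_ge0 ?ltW.
  rewrite PE ?mulr_ge0 ?(ltW K0) // mulrA ler_wpM2r ?(le_trans _ P1) //.
  by rewrite lerDr.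
have H0 : 0 <= H by apply: sumr_ge0 => r _; rewrite invr_ge0.
rewrite trilinear_sumE // normE lecR.
pose b' y := if Y < y%:R then b y else 0.
have b'1 y : nrm (b' y) <= 1 by rewrite /b'; case: ifP => _; rewrite ?nrm0 // nrm_le1.
have MB : (nL * nY ^ 2 <= B)%N by rewrite /B mulnDl mul1n leq_addl.
have XMB : (2 * nX * (nL * nY ^ 2) <= B)%N by rewrite /B mulnDl leq_addr.
have := @trilinear_core R a q nL nY nX B D beta gamma c u b' I q0 aq divD MB XMB
  (fun l => nrm_le1 (c1 l)) (fun x => nrm_le1 (u1 x)) b'1.
set S := nrm _ => core.
have S0 : 0 <= S by exact: nrm_ge0.
have CN0 : 0 <= 8 * K ^+ 2 * CD * CH * N `^ (1 - 10 * eta eps).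
  by rewrite !mulr_ge0 ?exprn_ge0 ?ltW.
rewrite -(@ler_pXn2r _ 2) ?nnegrE //.
apply: le_trans core _.
have := @core_bound_le R nL%:R nY%:R nX%:R D%:R H Lr Y N (CD * P) (CH * P) K q%:R.
rewrite !ler0n nLL nYY nXX Dd H0 Hh /= => /(_ isT isT isT isT isT K1).
have dP1 : 1 <= CD * P by rewrite mulr_ege1.
have hP1 : 1 <= CH * P by rewrite mulr_ege1.
move=> /(_ dP1 hP1 L1r N1 Y0 KY1 NKq qKLN).
have -> : (2 * nX * (nL * nY ^ 2) + 1)%:R = 2 * nX%:R * (nL%:R * nY%:R ^+ 2) + 1 :> R.
  by rewrite natrD natrM natrM [(nL * _)%:R]natrM natrX.
have -> : (nL * nY ^ 2)%:R = nL%:R * nY%:R ^+ 2 :> R by rewrite natrM natrX.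
rewrite -/H !natrM => cb; apply: le_trans cb _.
have LoverY : Lr / Y <= K * N `^ (- (eps / 3)).
  rewrite ler_pdivrMr // LE pwD mulrAC ler_wpM2r ?(ltW (pw0 _)) //.
(* The computation saves [N ^ (2 eps / 3)]; half of it is given up to match the term from equal
   weights. *)
have LsNY : Lr ^+ 2 * Num.sqrt (N * Y) <= K * N `^ (1 - eps / 3).
  have h : Num.sqrt (N * Y) <= K * N `^ (1 - 2 * rho).
    have w0 : 0 <= K * N `^ (1 - 2 * rho) by rewrite mulr_ge0 ?ltW.
    rewrite -[leRHS]ger0_norm // -sqrtr_sqr ler_wsqrtr //.
    apply: (@le_trans _ _ (N * (K * N `^ (1 - 4 * rho)))).
      by rewrite ler_wpM2l // ltW.
    rewrite mulrCA -{1}pwN -pwD exprMn -[(N `^ _) ^+ 2]powR_mulrn ?powR_ge0 // -powRrM.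
    apply: ler_pM; rewrite ?(ltW K0) ?(ltW (pw0 _)) //.
      by rewrite expr2 ler_peMr // ltW.
    by apply: pwle; clear - eps0 eps4 rho6 rho5; lra.
  have -> : Lr ^+ 2 = N `^ (2 * rho - 2 * eps / 3).
    by rewrite LE -powR_mulrn ?powR_ge0 // -powRrM; congr powR; clear - eps0 eps4 rho6 rho5; lra.
  apply: le_trans (ler_wpM2l (ltW (pw0 _)) h) _.
  rewrite mulrCA ler_wpM2l ?(ltW K0) // -pwD pwle //; clear - eps0 eps4 rho6 rho5; lra.
set dh := CD * P * (CH * P).
have dh1 : 1 <= dh by rewrite mulr_ege1.
have dh2 : CD * P <= dh ^+ 2.
  apply: (@le_trans _ _ dh); first by rewrite /dh ler_peMr // (le_trans _ dP1).
  by rewrite expr2 ler_peMr // (le_trans _ dh1).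
set Q := N `^ (2 - eps / 3).
have Q0 : 0 < Q by exact: pw0.
have T1 : 2 * (CD * P) * N ^+ 2 * (Lr / Y) <= 2 * dh ^+ 2 * (K * Q).
  have -> : K * Q = N ^+ 2 * (K * N `^ (- (eps / 3))) by rewrite /Q pwD pw2; ring.
  rewrite -mulrA; apply: ler_pM.
  - by rewrite mulr_ge0 // (le_trans _ dP1).
  - by rewrite !mulr_ge0 ?exprn_ge0 ?invr_ge0 ?(ltW N0) ?(ltW Y0) ?(le_trans _ L1r).
  - by rewrite ler_wpM2l.
  - by rewrite ler_wpM2l // exprn_ge0 // ltW.
have T2 : 48 * K ^+ 2 * dh ^+ 2 * N * (Lr ^+ 2 * Num.sqrt (N * Y)) <=
    48 * K ^+ 2 * dh ^+ 2 * (K * Q).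
  have -> : K * Q = N * (K * N `^ (1 - eps / 3)).
    rewrite mulrCA -[X in _ * (X * _)]pwN -pwD /Q; congr (_ * _ `^ _).
    by clear - eps0 eps4 rho6 rho5; lra.
  rewrite -[leLHS]mulrA; apply: ler_wpM2l; last by rewrite ler_wpM2l // ltW.
  by rewrite mulr_ge0 ?sqr_ge0 // mulr_ge0 // sqr_ge0.
apply: le_trans (lerD T1 T2) _.
have K2 : 1 <= K ^+ 2 by rewrite exprn_ege1.
apply: (@le_trans _ _ (64 * K ^+ 4 * dh ^+ 2 * Q)).
  have dQ : 0 <= dh ^+ 2 * Q by rewrite mulr_ge0 ?exprn_ge0 ?(le_trans _ dh1) ?ltW.
  have K14 : K <= K ^+ 4 by rewrite -{1}[K]expr1 ler_weXn2l.
  have K34 : K ^+ 3 <= K ^+ 4 by rewrite ler_weXn2l.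
  have := ler_wpM2r dQ K14; have := ler_wpM2r dQ K34.
  have : 0 <= K ^+ 4 * (dh ^+ 2 * Q) by rewrite mulr_ge0 ?exprn_ge0 ?(ltW K0).
  by clear; lra.
have -> : 64 * K ^+ 4 * dh ^+ 2 * Q = (8 * K ^+ 2 * CD * CH) ^+ 2 * (P ^+ 4 * Q).
  by rewrite /dh; ring.
rewrite [leRHS]exprMn; apply: ler_wpM2l; first by rewrite exprn_ge0 // !mulr_ge0 ?exprn_ge0 ?ltW.
rewrite -[P ^+ 4]powR_mulrn ?powR_ge0 // -[leRHS]powR_mulrn ?powR_ge0 //.
rewrite /P /Q -!powRrM -pwD pwle // /dl /eta.
(* The exponents require [8 dl + 2 - eps / 3 <= 2 (1 - 10 eps ^ 9)], that is
   [20 eps ^ 9 <= eps / 6]. *)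
have eps8 : eps ^+ 9 <= eps / 120.
  rewrite exprS ler_wpM2l ?(ltW eps0) //.
  apply: (@le_trans _ _ ((1 / 4) ^+ 8)); last by rewrite !exprS expr0; clear - eps0; lra.
  by rewrite lerXn2r ?nnegrE ?ltW.
clear - eps8 eps0; lra.
Qed.
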